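(* Consider the problem $\min_x F(x)$ subject to $Ax=b$, $x\in\mathcal X$ (the case with no $y$-variable), under Assumptions 1, 2 and 3 of the context. Let $\{(x^k,\lambda^k)\}$ be generated by the algorithm of the context, with parameters $\rho_x>0$ and $\rho>0$. Let $\theta=\frac{n}{N}$, and assume $\rho=\theta\rho_x$ and $$P^k\succeq L_f I,\quad\forall k .$$ For an integer $t\ge 1$ let $$\hat x^{t}=\frac{x^{t+1}+\theta\sum_{k=1}^t x^k}{1+\theta t}.$$ Then, for an arbitrary primal-dual solution $(x^*,\lambda^* )$, $$\max\Big\{\big|\mathbb E[F(\hat x^t)-F(x^* )]\big|,\ \mathbb E\|A\hat x^t-b\|\Big\}\le\frac{1}{1+\theta t}\left[(1-\theta)\big(F(x^0)-F(x^* )+\rho_x\|r^0\|^2\big)+\frac12\|x^0-x^*\|_{\tilde P}^2+\frac{\max\{(1+\|\lambda^*\|)^2,\,4\|\lambda^*\|^2\}}{2\rho_x}\right],$$ where $\tilde P=\hat P-\rho_xA^\top A$.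
   Context: Problem. $x=(x_1;\dots;x_N)$ is a real vector partitioned into $N$ blocks, $A=(A_1,\dots,A_N)$ is a real matrix partitioned conformally, $b$ is a vector, $\mathcal X=\mathcal X_1\times\cdots\times\mathcal X_N$, $u(x)=\sum_{i=1}^N u_i(x_i)$, and $F(x)=f(x)+u(x)$. The problem is $\min_x F(x)$ s.t. $\sum_{i=1}^N A_ix_i=b$, $x_i\in\mathcal X_i$ for $i=1,\dots,N$. Notation. $\|z\|_W^2:=z^\top Wz$ for a symmetric matrix $W$; $\|\cdot\|$ is the Euclidean norm; $W\succeq V$ means $W-V$ is positive semidefinite. For an index set $I\subset\{1,\dots,N\}$: $x_I$, $\mathcal X_I$, $A_I$, $\nabla_I f$ are the sub-vector, product of sets, column-block sub-matrix and partial gradient indexed by $I$, and $u_I(x_I)=\sum_{i\in I}u_i(x_i)$. Assumption 1 (convexity): the $\mathcal X_i$ are closed convex sets, $f$ is a smooth convex function, the $u_i$ are proper closed convex (possibly nonsmooth) functions. Assumption 2 (existence of a solution): there is at least one primal-dual solution $(x^*,\lambda^* )$, i.e. $x^*\in\mathcal X$, $Ax^*=b$ and $F(x)-F(x^* )-(x-x^* )^\top A^\top\lambda^*\ge 0$ for all $x\in\mathcal X$. Assumption 3 (Lipschitz partial gradient): there is a constant $L_f$ such that for every $I\subset\{1,\dots,N\}$ with $|I|=n$, $\|\nabla_I f(x+U_I\tilde x)-\nabla_I f(x)\|\le L_f\|\tilde x_I\|$ for all $x,\tilde x$, where $U_I\tilde x$ keeps the blocks of $\tilde x$ indexed by $I$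 and is zero elsewhere. Algorithm (randomized primal-dual block coordinate update, no $y$-variable). Fix $1\le n\le N$, a symmetric positive semidefinite block diagonal matrix $\hat P$ (blocks conformal with $x_1,\dots,x_N$), an initial point $x^0\in\mathcal X$ with $F(x^0)<\infty$, $\lambda^0=0$, $r^0=Ax^0-b$. For $k=0,1,\dots$: draw $I_k\subset\{1,\dots,N\}$ uniformly among all subsets of cardinality $n$, independently of the previous history. Set $x_i^{k+1}=x_i^k$ for $i\notin I_k$ and, for $I=I_k$, $$x_I^{k+1}\in\arg\min_{x_I\in\mathcal X_I}\langle\nabla_I f(x^k)-A_I^\top\lambda^k,x_I\rangle+u_I(x_I)+\tfrac{\rho_x}{2}\|A_I(x_I-x_I^k)+r^k\|^2+\tfrac12\|x_I-x_I^k\|_{P^k}^2,$$ $$r^{k+1}=r^k+A_I(x_I^{k+1}-x_I^k),\qquad \lambda^{k+1}=\lambda^k-\rho\, r^{k+1},$$ where $P^k=\hat P_{I_k}-\rho_xA_{I_k}^\top A_{I_k}$ and $\hat P_{I_k}$ denotes the diagonal blocks of $\hat P$ indexed by $I_k$. *)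

(* Defs.v *)
From HB Require Import structures.
From mathcomp Require Import all_boot all_order all_algebra.
From mathcomp Require Import all_classical all_reals all_analysis.

Set Implicit Arguments.
Unset Strict Implicit.
Unset Printing Implicit Defensive.

Import Order.TTheory GRing.Theory Num.Theory.
Import numFieldNormedType.Exports.

Local Open Scope classical_set_scope.
Local Open Scope ring_scope.

Section Euclidean.
Context {R : realType}.

Definition dotv n (x y : 'cV[R]_n) : R := (x^T *m y) ord0 ord0.

(* The library norm `|x| on matrices is the sup norm, not the Euclidean one. *)
Definition enorm n (x : 'cV[R]_n) : R := Num.sqrt (dotv x x).

(* W need not be positive semidefinite here. *)
Definition wnorm2 n (W : 'M[R]_n) (z : 'cV[R]_n) : R := dotv z (W *m z).

Definition psd n (W : 'M[R]_n) : Prop :=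
  W^T = W /\ forall z : 'cV[R]_n, 0 <= wnorm2 W z.

Definition loewner_ge n (W V : 'M[R]_n) : Prop := psd (W - V).

Definition grad n (f : 'cV[R]_n -> R) (x : 'cV[R]_n) : 'cV[R]_n :=
  \col_j 'D_(delta_mx j ord0) f x.

Definition proper_closed_convex n (u : 'cV[R]_n -> \bar R) : Prop :=
  [/\ (forall z, u z != -oo%E) /\ (exists z, (u z < +oo)%E),
      closed [set p : 'cV[R]_n * R | (u p.1 <= p.2%:E)%E] &
      forall (t : R) (y z : 'cV[R]_n), 0 < t < 1 ->
        (u (t *: y + (1 - t) *: z)%R <= t%:E * u y + (1 - t)%R%:E * u z)%E].

End Euclidean.

(* A vector of R^(d 0 + ... + d (N-1)) has the d i-dimensional blocks
   submxcol x i.  For a set of block indices I, the sub-vector x_I, the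
   sub-matrix A_I, etc. consist of the blocks enum_val a, a < #|I|, i.e. of the
   blocks in I listed in increasing order. *)
Section Blocks.
Context {R : realType} {N : nat} {d : 'I_N -> nat}.
Implicit Types (x : 'cV[R]_(\sum_i d i)) (I : {set 'I_N}).

Definition subdim I (a : 'I_#|I|) : nat := d (enum_val a).

Definition subvec I x : 'cV[R]_(\sum_a @subdim I a) :=
  \mxcol_a submxcol x (enum_val a).

Definition subcols m (A : 'M[R]_(m, \sum_i d i)) I :
    'M[R]_(m, \sum_a @subdim I a) :=
  \mxrow_a submxrow A (enum_val a).

Definition subdiag (M : 'M[R]_(\sum_i d i)) I : 'M[R]_(\sum_a @subdim I a) :=
  \mxdiag_a submxblock M (enum_val a) (enum_val a).

Definition block_diagonal (M : 'M[R]_(\sum_i d i)) : Prop :=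
  M = \mxdiag_i submxblock M i i.

(* U_I x *)
Definition blockmask I x : 'cV[R]_(\sum_i d i) :=
  \mxcol_i (if i \in I then submxcol x i else 0).

Definition subgrad_at I (f : 'cV[R]_(\sum_i d i) -> R) x := subvec I (grad f x).

Definition prodset (X : forall i, set 'cV[R]_(d i)) : set 'cV[R]_(\sum_i d i) :=
  [set x | forall i, X i (submxcol x i)].

Definition prodset_sub (X : forall i, set 'cV[R]_(d i)) I :
    set 'cV[R]_(\sum_a @subdim I a) :=
  [set z | forall a, X (enum_val a) (submxcol z a)].

Definition sepsum (u : forall i, 'cV[R]_(d i) -> \bar R) x : \bar R :=
  (\sum_i u i (submxcol x i))%E.

Definition sepsum_sub (u : forall i, 'cV[R]_(d i) -> \bar R) I
    (z : 'cV[R]_(\sum_a @subdim I a)) : \bar R :=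
  (\sum_a u (enum_val a) (submxcol z a))%E.

Definition objective (f : 'cV[R]_(\sum_i d i) -> R)
    (u : forall i, 'cV[R]_(d i) -> \bar R) x : \bar R :=
  ((f x)%:E + sepsum u x)%E.

Definition convexity (f : 'cV[R]_(\sum_i d i) -> R)
    (u : forall i, 'cV[R]_(d i) -> \bar R)
    (X : forall i, set 'cV[R]_(d i)) : Prop :=
  [/\ forall i, closed (X i) /\ convex_set (X i),
      (forall x, differentiable f x) /\ convex_function setT f &
      forall i, proper_closed_convex (u i)].

(* Since e - +oo = -oo for every e in \bar R, the last clause forces the
   objective to be finite at xs. *)
Definition primal_dual_solution m (f : 'cV[R]_(\sum_i d i) -> R)
    (u : forall i, 'cV[R]_(d i) -> \bar R) (X : forall i, set 'cV[R]_(d i))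
    (A : 'M[R]_(m, \sum_i d i)) (b : 'cV[R]_m)
    (xs : 'cV[R]_(\sum_i d i)) (ls : 'cV[R]_m) : Prop :=
  [/\ prodset X xs, A *m xs = b &
      forall x, prodset X x ->
        (0 <= objective f u x - objective f u xs
              - (dotv (x - xs) (A^T *m ls))%:E)%E].

Definition lipschitz_partial_gradient (n : nat) (Lf : R)
    (f : 'cV[R]_(\sum_i d i) -> R) : Prop :=
  forall I, #|I| = n -> forall x y,
    enorm (subgrad_at I f (x + blockmask I y) - subgrad_at I f x)
      <= Lf * enorm (subvec I y).

(* P^k = Phat_I - rho_x A_I^T A_I for I = I_k *)
Definition prox_matrix m (Phat : 'M[R]_(\sum_i d i)) (rhox : R)
    (A : 'M[R]_(m, \sum_i d i)) I : 'M[R]_(\sum_a @subdim I a) :=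
  subdiag Phat I - rhox *: ((subcols A I)^T *m subcols A I).

Definition subproblem m (f : 'cV[R]_(\sum_i d i) -> R)
    (u : forall i, 'cV[R]_(d i) -> \bar R)
    (A : 'M[R]_(m, \sum_i d i)) (Phat : 'M[R]_(\sum_i d i)) (rhox : R) I
    (xk : 'cV[R]_(\sum_i d i)) (rk lk : 'cV[R]_m)
    (z : 'cV[R]_(\sum_a @subdim I a)) : \bar R :=
  ((dotv (subgrad_at I f xk - (subcols A I)^T *m lk) z)%:E
   + sepsum_sub u z
   + (rhox / 2 * enorm (subcols A I *m (z - subvec I xk) + rk) ^+ 2
      + 2^-1 * wnorm2 (prox_matrix Phat rhox A I) (z - subvec I xk))%:E)%E.

Definition is_argmin (S : Type) (D : set S) (g : S -> \bar R) (z : S) : Prop :=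
  D z /\ forall y, D y -> (g z <= g y)%E.

(* Events determined by I_0, ..., I_(k-1), x^0, ..., x^k; the multipliers and
   residuals up to step k are functions of x^0, ..., x^k. *)
Definition history (T : Type) (I : nat -> T -> {set 'I_N})
    (x : nat -> T -> 'cV[R]_(\sum_i d i)) (k : nat) : set (set T) :=
  <<s [set E | (exists j S, (j < k)%N /\ E = I j @^-1` [set S]) \/
               (exists j c (B : set R), [/\ (j <= k)%N, measurable B &
                  E = (fun w => x j w c ord0) @^-1` B])] >>.

(* The randomness may also come from the choice of a minimizer when the
   subproblem has several ones: x^(k+1) need not be a function of I_0..I_k. *)
Record generated_by_algorithm m (f : 'cV[R]_(\sum_i d i) -> R)
    (u : forall i, 'cV[R]_(d i) -> \bar R) (X : forall i, set 'cV[R]_(d i))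
    (A : 'M[R]_(m, \sum_i d i)) (b : 'cV[R]_m)
    (Phat : 'M[R]_(\sum_i d i)) (rhox rho : R) (n : nat)
    (x0 : 'cV[R]_(\sum_i d i))
    (disp : measure_display) (T : measurableType disp) (P : probability T R)
    (I : nat -> T -> {set 'I_N}) (x : nat -> T -> 'cV[R]_(\sum_i d i))
    (r lam : nat -> T -> 'cV[R]_m) : Prop := {
  draw_measurable : forall k S, measurable (I k @^-1` [set S]);
  iterate_measurable : forall k c,
    measurable_fun setT (fun w => x k w c ord0);
  draw_card : forall k w, #|I k w| = n;
  draw_uniform : forall k (S : {set 'I_N}), #|S| = n ->
    P (I k @^-1` [set S]) = (('C(N, n)%:R)^-1)%:E;
  draw_independent : forall k S E, history I x k E ->
    P (I k @^-1` [set S] `&` E) = (P (I k @^-1` [set S]) * P E)%E;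
  init_feasible : prodset X x0;
  init_finite : (objective f u x0 < +oo)%E;
  init_x : forall w, x 0%N w = x0;
  init_lam : forall w, lam 0%N w = 0;
  init_r : forall w, r 0%N w = A *m x0 - b;
  step_fixed : forall k w i, i \notin I k w ->
    submxcol (x k.+1 w) i = submxcol (x k w) i;
  step_argmin : forall k w,
    is_argmin (prodset_sub X (I := I k w))
      (subproblem f u A Phat rhox (x k w) (r k w) (lam k w))
      (subvec (I k w) (x k.+1 w));
  step_r : forall k w,
    r k.+1 w = r k w + subcols A (I k w) *m
      (subvec (I k w) (x k.+1 w) - subvec (I k w) (x k w));
  step_lam : forall k w, lam k.+1 w = lam k w - rho *: r k.+1 w
}.

Definition ergodic_average (T : Type) (x : nat -> T -> 'cV[R]_(\sum_i d i))
    (theta : R) (t : nat) (w : T) : 'cV[R]_(\sum_i d i) :=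
  (1 + theta * t%:R)^-1 *:
    (x t.+1 w + theta *: \sum_(1 <= k < t.+1) x k w).

End Blocks.

(* Main.v *)
(** Fix a primal-dual solution [xs] and let [gap_i] be the [i]-th block of the
    linearized primal-dual gap at the current iterate.  The optimality of the
    block step and the descent lemma give, along every trajectory, an energy
    inequality [V_(k+1) <= V_k - sum_(i in I_k) gap_i + theta sum_i gap_i], and
    the last two terms cancel on average over the uniform draw of [I_k].
    Telescoping the multiplier updates, with the random test multiplier
    [- g (A xh - b) / |A xh - b|], bounds [V_(t+1) + c] from below by
    [1 + theta t] times the objective error plus [g] times the residual norm at
    the ergodic average [xh]; for [g = max (1 + |ls|) (2 |ls|)] this dominates
    both the absolute objective error and the residual norm.  As
    [V_(k+1) + c >= 0] on every trajectory, the right side of the energy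
    inequality plus [c] is almost surely nonnegative for every possible draw, so
    all expectations are integrals of nonnegative functions and no
    integrability of the iterates has to be established. *)
Require Import Defs.
From HB Require Import structures.
From mathcomp Require Import all_boot all_order all_algebra.
From mathcomp Require Import all_classical all_reals all_analysis.
From mathcomp Require Import measurable_realfun ring lra.
Set Implicit Arguments.
Unset Strict Implicit.
Unset Printing Implicit Defensive.
Import Order.TTheory GRing.Theory Num.Theory.
Import numFieldNormedType.Exports.
Local Open Scope classical_set_scope.
Local Open Scope ring_scope.

(** * Inner product, Euclidean norm and quadratic forms *)

Section Euclidean.
Context {R : realType}.

Lemma dotvE n (x y : 'cV[R]_n) : dotv x y = \sum_j x j ord0 * y j ord0.
Proof. by rewrite /dotv mxE; apply: eq_bigr => j _; rewrite mxE. Qed.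

Lemma dotvC n (x y : 'cV[R]_n) : dotv x y = dotv y x.
Proof. by rewrite !dotvE; apply: eq_bigr => j _; rewrite mulrC. Qed.

Lemma dotvDr n (x y z : 'cV[R]_n) : dotv x (y + z) = dotv x y + dotv x z.
Proof. by rewrite /dotv mulmxDr mxE. Qed.

Lemma dotvZr n a (x y : 'cV[R]_n) : dotv x (a *: y) = a * dotv x y.
Proof. by rewrite /dotv -scalemxAr mxE. Qed.

Lemma dotvNr n (x y : 'cV[R]_n) : dotv x (- y) = - dotv x y.
Proof. by rewrite -scaleN1r dotvZr mulN1r. Qed.

Lemma dotvDl n (x y z : 'cV[R]_n) : dotv (y + z) x = dotv y x + dotv z x.
Proof. by rewrite !(dotvC _ x) dotvDr. Qed.

Lemma dotvZl n a (x y : 'cV[R]_n) : dotv (a *: y) x = a * dotv y x.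
Proof. by rewrite !(dotvC _ x) dotvZr. Qed.

Lemma dotvNl n (x y : 'cV[R]_n) : dotv (- y) x = - dotv y x.
Proof. by rewrite !(dotvC _ x) dotvNr. Qed.

Definition dotvEl := (dotvDl, dotvDr, dotvNl, dotvNr, dotvZl, dotvZr).

Lemma dotv0r n (x : 'cV[R]_n) : dotv x 0 = 0.
Proof. by rewrite -(scale0r 0) dotvZr mul0r. Qed.

Lemma dotv0l n (x : 'cV[R]_n) : dotv 0 x = 0.
Proof. by rewrite dotvC dotv0r. Qed.

Lemma dotv_ge0 n (x : 'cV[R]_n) : 0 <= dotv x x.
Proof. by rewrite dotvE sumr_ge0 // => j _; rewrite -expr2 sqr_ge0. Qed.

Lemma dotv_mull m n (B : 'M[R]_(m, n)) x y : dotv x (B *m y) = dotv (B^T *m x) y.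
Proof. by rewrite /dotv trmx_mul trmxK mulmxA. Qed.

Lemma enorm_ge0 n (x : 'cV[R]_n) : 0 <= enorm x.
Proof. exact: sqrtr_ge0. Qed.

Lemma enorm2E n (x : 'cV[R]_n) : enorm x ^+ 2 = dotv x x.
Proof. by rewrite sqr_sqrtr ?dotv_ge0. Qed.

Lemma enorm_eq0 n (x : 'cV[R]_n) : enorm x = 0 -> x = 0.
Proof.
move=> x0; apply/colP => j; rewrite mxE; apply/eqP.
have : dotv x x = 0 by rewrite -enorm2E x0 expr0n.
rewrite dotvE => /eqP; rewrite psumr_eq0 => [/allP/(_ j)|i _]; last first.
  by rewrite -expr2 sqr_ge0.
by rewrite mem_index_enum -expr2 sqrf_eq0 => /(_ isT).
Qed.

(** Cauchy-Schwarz. For nonzero vectors, expanding the squared norm of [|y| x - |x| y] gives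
    [2 |x| |y| (|x| |y| - <x, y>)], which is therefore nonnegative. *)
Lemma dotv_le_enorm n (x y : 'cV[R]_n) : dotv x y <= enorm x * enorm y.
Proof.
have [y0|/eqP yn0] := eqVneq (enorm y) 0.
  by rewrite (enorm_eq0 y0) dotv0r mulr_ge0 ?enorm_ge0.
have [x0|/eqP xn0] := eqVneq (enorm x) 0.
  by rewrite (enorm_eq0 x0) dotv0l mulr_ge0 ?enorm_ge0.
have xp : 0 < enorm x by rewrite lt_neqAle enorm_ge0 eq_sym (introN eqP).
have yp : 0 < enorm y by rewrite lt_neqAle enorm_ge0 eq_sym (introN eqP).
have := dotv_ge0 (enorm y *: x - enorm x *: y).
rewrite !dotvEl -!enorm2E (dotvC y x).
set e := enorm x in xp *; set g := enorm y in yp *; set c := dotv x y => h.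
have h2 : 0 <= e * g * (e * g - c) by nra.
by move: h2; rewrite pmulr_rge0 ?subr_ge0 // mulr_gt0.
Qed.

Lemma enormN n (x : 'cV[R]_n) : enorm (- x) = enorm x.
Proof. by rewrite /enorm !dotvEl opprK. Qed.

Lemma enormZ n a (x : 'cV[R]_n) : 0 <= a -> enorm (a *: x) = a * enorm x.
Proof.
move=> a0; rewrite /enorm !dotvEl mulrA sqrtrM ?mulr_ge0 //.
by rewrite -expr2 sqrtr_sqr ger0_norm.
Qed.

Lemma wnorm2D n (W : 'M[R]_n) x y : W^T = W ->
  wnorm2 W (x + y) = wnorm2 W x + 2 * dotv (W *m x) y + wnorm2 W y.
Proof.
move=> Ws; rewrite /wnorm2 mulmxDr !dotvEl.
have -> : dotv y (W *m x) = dotv (W *m x) y by rewrite dotvC.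
have -> : dotv x (W *m y) = dotv (W *m x) y by rewrite dotv_mull Ws.
ring.
Qed.

Lemma wnorm2Z n (W : 'M[R]_n) a x : wnorm2 W (a *: x) = a ^+ 2 * wnorm2 W x.
Proof. by rewrite /wnorm2 -scalemxAr !dotvEl; ring. Qed.

Lemma wnorm2N n (W : 'M[R]_n) x : wnorm2 W (- x) = wnorm2 W x.
Proof. by rewrite /wnorm2 mulmxN !dotvEl opprK. Qed.

Lemma wnorm2B n (W V : 'M[R]_n) x : wnorm2 (W - V) x = wnorm2 W x - wnorm2 V x.
Proof. by rewrite /wnorm2 mulmxBl !dotvEl. Qed.

Lemma wnorm2_gram m n (B : 'M[R]_(m, n)) a x :
  wnorm2 (a *: (B^T *m B)) x = a * dotv (B *m x) (B *m x).
Proof. by rewrite /wnorm2 -scalemxAl dotvZr -mulmxA dotv_mull trmxK. Qed.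

Lemma wnorm2_scalar n a (x : 'cV[R]_n) : wnorm2 a%:M x = a * dotv x x.
Proof. by rewrite /wnorm2 mul_scalar_mx dotvZr. Qed.

End Euclidean.

(** * Sub-vectors, masks and block diagonal matrices *)

Section Blocks.
Context {R : realType} {N : nat} {d : 'I_N -> nat}.
Implicit Types (x y : 'cV[R]_(\sum_i d i)) (I : {set 'I_N}).

Lemma dotv_blocks x y :
  dotv x y = \sum_i dotv (submxcol x i) (submxcol y i).
Proof.
rewrite -{1}(submxcolK x) -{1}(submxcolK y) /dotv tr_mxcol mul_mxrow_mxcol.
by rewrite summxE.
Qed.

Lemma submxcolD x y i : submxcol (x + y) i = submxcol x i + submxcol y i.
Proof. by apply/matrixP => a c; rewrite !mxE. Qed.

Lemma submxcolN x i : submxcol (- x) i = - submxcol x i.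
Proof. by apply/matrixP => a c; rewrite !mxE. Qed.

Lemma submxcolZ a x i : submxcol (a *: x) i = a *: submxcol x i.
Proof. by apply/matrixP => c e; rewrite !mxE. Qed.

Lemma subvecK I x a : submxcol (subvec I x) a = submxcol x (enum_val a).
Proof. by rewrite /subvec mxcolK. Qed.

Lemma submxcol_blockmask I x i :
  submxcol (blockmask I x) i = if i \in I then submxcol x i else 0.
Proof. by rewrite /blockmask mxcolK. Qed.

Lemma subvecD I x y : subvec I (x + y) = subvec I x + subvec I y.
Proof. by apply/matrixP => a c; rewrite !mxE. Qed.

Lemma subvecN I x : subvec I (- x) = - subvec I x.
Proof. by apply/matrixP => a c; rewrite !mxE. Qed.

Lemma subvecZ I a x : subvec I (a *: x) = a *: subvec I x.
Proof. by apply/matrixP => c e; rewrite !mxE. Qed.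

Lemma blockmaskZ I a x : blockmask I (a *: x) = a *: blockmask I x.
Proof.
rewrite -[RHS]submxcolK; apply/eq_mxcol => i.
by rewrite submxcolZ submxcol_blockmask submxcolZ; case: ifP; rewrite ?scaler0.
Qed.

Lemma blockmaskD I x y : blockmask I (x + y) = blockmask I x + blockmask I y.
Proof.
rewrite -[RHS]submxcolK; apply/eq_mxcol => i.
by rewrite submxcolD !submxcol_blockmask submxcolD; case: ifP; rewrite ?addr0.
Qed.

Lemma blockmask_id I x :
  (forall i, i \notin I -> submxcol x i = 0) -> blockmask I x = x.
Proof.
move=> x0; rewrite -[RHS]submxcolK; apply/eq_mxcol => i.
by case: ifPn => // /x0 ->.
Qed.

Lemma dotv_subvec I x y :
  dotv (subvec I x) (subvec I y) =
  \sum_(i in I) dotv (submxcol x i) (submxcol y i).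
Proof.
have -> : dotv (subvec I x) (subvec I y) =
    \sum_(a < #|I|) dotv (submxcol x (enum_val a)) (submxcol y (enum_val a)).
  by rewrite /dotv tr_mxcol mul_mxrow_mxcol summxE.
by rewrite -(big_enum_val (fun i => dotv (submxcol x i) (submxcol y i))).
Qed.

(** Blocks outside [I] contribute zero. This moves computations from the space of sub-vectors, whose
    dimension depends on [I], to the fixed full space. *)
Lemma dotv_subvec_mask I x y :
  dotv (subvec I x) (subvec I y) = dotv x (blockmask I y).
Proof.
rewrite dotv_subvec dotv_blocks [RHS](bigID (mem I)) /= [X in _ + X]big1 ?addr0.
  by apply: eq_bigr => i iI; rewrite submxcol_blockmask iI.
by move=> i /negbTE iI; rewrite submxcol_blockmask iI dotv0r.
Qed.

Lemma dotv_blockmask_sym I x y : dotv (blockmask I x) y = dotv x (blockmask I y).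
Proof. by rewrite dotvC -dotv_subvec_mask dotvC dotv_subvec_mask. Qed.

Lemma mulmx_blocks m (A : 'M[R]_(m, \sum_i d i)) x :
  A *m x = \sum_i submxrow A i *m submxcol x i.
Proof. by rewrite -{1}(submxrowK A) -{1}(submxcolK x) mul_mxrow_mxcol. Qed.

Lemma subcols_subvec m (A : 'M[R]_(m, \sum_i d i)) I x :
  subcols A I *m subvec I x = A *m blockmask I x.
Proof.
rewrite /subcols /subvec mul_mxrow_mxcol.
rewrite -(big_enum_val (fun i => submxrow A i *m submxcol x i)) /= mulmx_blocks.
rewrite [RHS](bigID (mem I)) /= [X in _ + X]big1 ?addr0.
  by apply: eq_bigr => i iI; rewrite submxcol_blockmask iI.
by move=> i /negbTE iI; rewrite submxcol_blockmask iI mulmx0.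
Qed.

Lemma submxcol_block_diagonal (M : 'M[R]_(\sum_i d i)) x i :
  block_diagonal M -> submxcol (M *m x) i = submxblock M i i *m submxcol x i.
Proof.
by move=> Md; rewrite Md -{1}(submxcolK x) mul_mxdiag_mxcol mxcolK -Md.
Qed.

(** A block diagonal matrix acts inside each block, so it preserves the vectors supported on [I]. *)
Lemma blockmask_block_diagonal (M : 'M[R]_(\sum_i d i)) I x :
  block_diagonal M -> blockmask I x = x -> blockmask I (M *m x) = M *m x.
Proof.
move=> Md xI; apply: blockmask_id => i /negbTE iI.
by rewrite submxcol_block_diagonal // -xI submxcol_blockmask iI mulmx0.
Qed.

Lemma wnorm2_subdiag (M : 'M[R]_(\sum_i d i)) I x : block_diagonal M ->
  wnorm2 (subdiag M I) (subvec I x) = wnorm2 M (blockmask I x).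
Proof.
move=> Md; rewrite /wnorm2.
have -> : subdiag M I *m subvec I x = subvec I (M *m blockmask I x).
  rewrite /subdiag {1}/subvec mul_mxdiag_mxcol; apply/eq_mxcol => a.
  by rewrite submxcol_block_diagonal // submxcol_blockmask enum_valP.
by rewrite dotvC dotv_subvec_mask dotvC.
Qed.

Lemma sepsum_sub_subvec (u : forall i, 'cV[R]_(d i) -> \bar R) I x :
  sepsum_sub u (subvec I x) = (\sum_(i in I) u i (submxcol x i))%E.
Proof.
rewrite /sepsum_sub [RHS](big_enum_val (fun i => u i (submxcol x i))) /=.
by apply: eq_bigr => a _; rewrite subvecK.
Qed.

Lemma prodset_sub_subvec (X : forall i, set 'cV[R]_(d i)) I x :
  prodset_sub X (subvec I x) <-> forall i, i \in I -> X i (submxcol x i).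
Proof.
split=> [h i iI|h a]; last by rewrite subvecK; apply/h/enum_valP.
by have := h (enum_rank_in iI i); rewrite subvecK enum_rankK_in.
Qed.

(* Completing [P^k = Phat_I - rho_x A_I^T A_I] cancels the quadratic part of
   the penalty term. *)
Lemma subproblem_subvec m (f : 'cV[R]_(\sum_i d i) -> R)
    (u : forall i, 'cV[R]_(d i) -> \bar R) (A : 'M[R]_(m, \sum_i d i))
    (Phat : 'M[R]_(\sum_i d i)) (rhox : R) I x (r l : 'cV[R]_m) y :
  block_diagonal Phat ->
  subproblem f u A Phat rhox x r l (subvec I y) =
  (\sum_(i in I) u i (submxcol y i) +
   (dotv (grad f x - A^T *m l) (blockmask I y) +
    rhox * dotv r (A *m blockmask I (y - x)) + rhox / 2 * dotv r r +
    2^-1 * wnorm2 Phat (blockmask I (y - x)))%:E)%E.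
Proof.
move=> Pd; rewrite /subproblem sepsum_sub_subvec.
rewrite [X in (X + _)%E]addeC -addeA; congr (_ + _)%E; rewrite -EFinD; congr EFin.
(* The term [- rhox / 2 |A_I (y - x)_I|^2] coming from the proximal matrix meets its opposite in the
   expanded penalty, which leaves only the part linear in [y]. *)
rewrite -subvecN -subvecD subcols_subvec enorm2E /prox_matrix wnorm2B.
rewrite wnorm2_gram wnorm2_subdiag // subcols_subvec !dotvEl.
rewrite (_ : dotv ((subcols A I)^T *m l) (subvec I y) =
             dotv (A^T *m l) (blockmask I y)); last first.
  by rewrite -!dotv_mull -subcols_subvec; rewrite !dotv_mull ?trmxK -?dotv_mull.
rewrite /subgrad_at dotv_subvec_mask.
rewrite (dotvC (A *m _) r).
lra.
Qed.

End Blocks.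

(** * Directional derivatives, the gradient inequality and the descent lemma *)

Section Calculus.
Context {R : realType}.

(** The steps [1 / (k + 1)] tend to 0 without reaching it. The sequential form serves both for
    limits of inequalities and for the measurability of the gradient. *)
Lemma derive_cvg_seq n (f : 'cV[R]_n -> R) x v : derivable f x v ->
  (fun k : nat => k.+1%:R * (f (k.+1%:R^-1 *: v + x) - f x)) @ \oo -->
  'D_v f x.
Proof.
move=> dfx.
have h : (fun k : nat => (k.+1%:R^-1 : R)) @ \oo --> (0 : R)^'.
  move=> A; rewrite /dnbhs /within /= => -[e e0 eA].
  have h0 : \forall k \near \oo, ball (0 : R) e (k.+1%:R^-1).
    exact: (cvg_ball (@cvg_harmonic R)) e0.
  change (\forall k \near \oo, A (k.+1%:R^-1)).
  apply: filterS h0 => k ke; apply: eA => //.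
have := cvg_comp _ _ h dfx.
apply: cvg_trans; apply: near_eq_cvg; near=> k => /=.
by rewrite invrK.
Unshelve. all: by end_near. Qed.

Lemma derive_grad n (f : 'cV[R]_n -> R) x v :
  differentiable f x -> 'D_v f x = dotv (grad f x) v.
Proof.
move=> dfx; rewrite deriveE // {1}(matrix_sum_delta v) linear_sum dotvE /=.
apply: eq_bigr => j _; rewrite big_ord1 linearZ /= /grad mxE deriveE //.
by rewrite mulrC.
Qed.

Lemma convex_functionP n (f : 'cV[R]_n -> R) x y s : convex_function setT f ->
  0 <= s <= 1 -> f (s *: x + (1 - s) *: y) <= s * f x + (1 - s) * f y.
Proof.
move=> cf /andP[s0 s1].
by have := cf (Itv01 s0 s1) x y; rewrite !inE => /(_ I I).
Qed.

(** By convexity, each difference quotient from [x] towards [y] with step in [(0, 1]] is at most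
    [f y - f x]; the limit keeps this bound. *)
Lemma convex_gradient_le n (f : 'cV[R]_n -> R) x y :
  differentiable f x -> convex_function setT f ->
  dotv (grad f x) (y - x) <= f y - f x.
Proof.
move=> dfx cf; rewrite -derive_grad //.
have h := derive_cvg_seq (diff_derivable (v := y - x) dfx).
rewrite -(cvg_lim _ h) //.
apply: limr_le; first by apply/cvg_ex; eexists; exact: h.
near=> k.
have k0 : 0 < k.+1%:R :> R by rewrite ltr0n.
have k01 : 0 <= (k.+1%:R^-1 : R) <= 1.
  by rewrite invr_ge0 ler0n invf_le1 ?ler1n.
have := convex_functionP y x cf k01.
rewrite (_ : _ *: y + _ = k.+1%:R^-1 *: (y - x) + x); last first.
  by rewrite scalerBl scale1r scalerBr addrA addrAC.
rewrite -ler_pdivlMl // lerBlDr mulrBr mulrBl mul1r; move: (_^-1) => s h1; lra.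
Unshelve. all: by end_near. Qed.

Lemma is_derive_line n (f : 'cV[R]_n -> R) x v s :
  differentiable f (x + s *: v) ->
  is_derive s 1 (fun t => f (x + t *: v)) (dotv (grad f (x + s *: v)) v).
Proof.
move=> df; rewrite -derive_grad //.
have E : (fun h : R => h^-1 *: (((fun t : R => f (x + t *: v)) \o shift s) (h *: 1) -
      f (x + s *: v))) =
    (fun h : R => h^-1 *: ((f \o shift (x + s *: v)) (h *: v) - f (x + s *: v))).
  apply/funext => h /=; congr (_ *: (f _ - _)).
  by rewrite scalerDl addrCA [h *: 1]mulr1.
split; last by rewrite /derive E.
by rewrite /derivable E; exact: diff_derivable.
Qed.

(** The mean value theorem is applied to [f] along the segment minus its linear part and the
    quadratic [s^2 L / 2]: the derivative of the difference is nonpositive inside the segment. Here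
    [L] already contains the squared length of [v]. *)
Lemma descent n (f : 'cV[R]_n -> R) x v L :
  (forall y, differentiable f y) ->
  (forall s, 0 < s < 1 ->
    dotv (grad f (x + s *: v) - grad f x) v <= s * L) ->
  f (x + v) - f x <= dotv (grad f x) v + L / 2.
Proof.
move=> df hL.
pose c := dotv (grad f x) v.
pose phi s := f (x + s *: v) - (s * c + s ^+ 2 * (L / 2)).
have dphi (s : R) : is_derive s 1 phi
    (dotv (grad f (x + s *: v)) v - (c + s * L)).
  apply: is_deriveB; first exact: is_derive_line.
  apply: is_derive_eq; rewrite /GRing.scale /=; lra.
have cphi : {within `[(0 : R), 1], continuous phi}.
  apply: continuous_subspaceT => s.
  by apply: differentiable_continuous; apply/derivable1_diffP; case: (dphi s).
have [s] := MVT ltr01 (fun s _ => dphi s) cphi.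
rewrite in_itv /= => /hL.
rewrite /phi dotvDl dotvNl -/c scale1r scale0r addr0.
lra.
Qed.

End Calculus.

(** * Extended-valued proper closed convex functions *)

Section ProperClosedConvex.
Context {R : realType} {n : nat} (u : 'cV[R]_n -> \bar R).
Context (u_pcc : proper_closed_convex u).

Lemma pcc_gtNy z : u z != -oo%E.
Proof. by have [[]] := u_pcc. Qed.

Lemma pcc_fin_num z : (u z < +oo)%E -> u z \is a fin_num.
Proof. by move=> h; rewrite fin_numE pcc_gtNy lt_eqF. Qed.

Lemma pcc_convex s y z : (u y < +oo)%E -> (u z < +oo)%E -> 0 <= s <= 1 ->
  (u (s *: y + (1 - s) *: z) <= (s * fine (u y) + (1 - s) * fine (u z))%:E)%E.
Proof.
move=> /pcc_fin_num yf /pcc_fin_num zf /andP[s0 s1].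
rewrite EFinD !EFinM !fineK //.
have [->|sn0] := eqVneq s 0.
  by rewrite scale0r add0r subr0 scale1r mul0e add0e mul1e.
have [->|sn1] := eqVneq s 1.
  by rewrite subrr scale0r addr0 scale1r mul0e adde0 mul1e.
have [_ _ ->] := u_pcc => //.
by rewrite !lt_neqAle eq_sym sn0 s0 sn1 s1.
Qed.

(** A sublevel set is the slice at height [c] of the closed epigraph. *)
Lemma pcc_closed_sublevel (c : R) : closed [set z | (u z <= c%:E)%E].
Proof.
have [_ uc _] := u_pcc.
apply: (@preimage_closed _ _ (fun z => (z, c)) _ _ uc) => z _.
exact: (@cvg_pair _ _ _ (nbhs z) (nbhs z) (nbhs c) _ _ _ id (fun=> c)
  (@cvg_id _ _) (@cvg_cst _ c _ (nbhs z) _)).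
Qed.

End ProperClosedConvex.

(** First-order optimality without a limit: if [a < 0], the single choice [s = - a / (w - 2 a)]
    gives [a + s w = - 2 a^2 / (w - 2 a) < 0]. *)
Lemma linear_term_ge0 (R : realFieldType) (a w : R) : 0 <= w ->
  (forall s, 0 < s < 1 -> 0 <= s * a + s ^+ 2 * w) -> 0 <= a.
Proof.
move=> w0 h; rewrite leNgt; apply/negP => a0.
have wa : 0 < w - 2 * a by lra.
pose s := - a / (w - 2 * a).
have sE : s * (w - 2 * a) = - a by rewrite /s divfK // gt_eqF.
have s0 : 0 < s by rewrite /s divr_gt0 // oppr_gt0.
have s1 : s < 1 by nra.
have := h s; rewrite s0 s1 => /(_ isT).
rewrite expr2 -mulrA -mulrDr pmulr_rge0 //; nra.
Qed.

Lemma EFin_adde_lty (R : realDomainType) (a : R) (y : \bar R) :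
  (a%:E + y < +oo)%E -> (y < +oo)%E.
Proof. by case: y => // y _; rewrite ltry. Qed.

(** * Deterministic analysis of one block update *)

Section OneStep.
Context {R : realType} {N : nat} {d : 'I_N -> nat} {m : nat}.
Context (f : 'cV[R]_(\sum_i d i) -> R) (u : forall i, 'cV[R]_(d i) -> \bar R).
Context (X : forall i, set 'cV[R]_(d i)).
Context (A : 'M[R]_(m, \sum_i d i)) (Phat : 'M[R]_(\sum_i d i)) (rhox : R).
Implicit Types (x z : 'cV[R]_(\sum_i d i)) (I : {set 'I_N}) (r l : 'cV[R]_m).
Arguments u : clear implicits.
Arguments X : clear implicits.

Definition ufin z := forall i, (u i (submxcol z i) < +oo)%E.

(** Since [fine] sends infinite values to 0, [usum] and [fobj] represent the true objective only at
    points satisfying [ufin]. *)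
Definition usum z : R := \sum_i fine (u i (submxcol z i)).

Definition fobj z : R := f z + usum z.

(* The i-th block of the linearized primal-dual gap between [z] and [xs]. *)
Definition block_gap xs z r l i : R :=
  dotv (submxcol (grad f z - A^T *m l + rhox *: (A^T *m r)) i)
       (submxcol (z - xs) i)
  + (fine (u i (submxcol z i)) - fine (u i (submxcol xs i))).

Lemma sum_block_gap_in I xs z r l :
  \sum_(i in I) block_gap xs z r l i =
  dotv (grad f z - A^T *m l + rhox *: (A^T *m r)) (blockmask I (z - xs)) +
  (\sum_(i in I) fine (u i (submxcol z i)) -
   \sum_(i in I) fine (u i (submxcol xs i))).
Proof.
by rewrite big_split /= sumrB -dotv_subvec_mask dotv_subvec.
Qed.

Lemma sum_block_gap xs z r l :
  \sum_i block_gap xs z r l i =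
  dotv (grad f z - A^T *m l + rhox *: (A^T *m r)) (z - xs) + (usum z - usum xs).
Proof. by rewrite big_split /= sumrB -dotv_blocks. Qed.

Context (conv : convexity f u X).

Lemma u_pcc i : proper_closed_convex (u i). Proof. by case: conv. Qed.

Lemma ufin_fin_num z i : ufin z -> u i (submxcol z i) \is a fin_num.
Proof. by move=> /(_ i); apply/pcc_fin_num/u_pcc. Qed.

Lemma sum_u_fine I z : (forall i, i \in I -> (u i (submxcol z i) < +oo)%E) ->
  (\sum_(i in I) u i (submxcol z i))%E =
  (\sum_(i in I) fine (u i (submxcol z i)))%:E.
Proof.
move=> zf; rewrite -sumEFin; apply: eq_bigr => i iI.
by rewrite fineK // pcc_fin_num ?zf //; exact: u_pcc.
Qed.

Lemma objectiveE z : ufin z -> objective f u z = (fobj z)%:E.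
Proof.
move=> zf; rewrite /objective /sepsum EFinD; congr (_ + _)%E.
rewrite /usum -sumEFin; apply: eq_bigr => i _.
by rewrite fineK // ufin_fin_num.
Qed.

(** No summand is [-oo], so a single [+oo] would make the whole sum infinite. *)
Lemma sum_u_lty (Q : pred 'I_N) (z : forall i, 'cV[R]_(d i)) :
  (\sum_(i | Q i) u i (z i) < +oo)%E -> forall i, Q i -> (u i (z i) < +oo)%E.
Proof.
move=> h i Qi; rewrite ltey; apply/negP => /eqP ui.
move: h; rewrite ltey => /eqP; apply; apply/esum_eqyP; last first.
  by exists i; split; rewrite ?mem_index_enum.
by move=> j _; exact/pcc_gtNy/u_pcc.
Qed.

Lemma objective_lty z : (objective f u z < +oo)%E -> ufin z.
Proof.
move=> h i; apply: (@sum_u_lty xpredT (fun i => submxcol z i)) => //.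
exact: EFin_adde_lty h.
Qed.

Lemma prodset_convex i s (y z : 'cV[R]_(d i)) :
  X i y -> X i z -> 0 <= s <= 1 -> X i (s *: y + (1 - s) *: z).
Proof.
move=> Xy Xz /andP[s0 s1]; have [/(_ i)[_ cX] _ _] := conv.
by have := cX y z (Itv01 s0 s1); rewrite !inE; apply.
Qed.

Lemma ufin_convex s y z : ufin y -> ufin z -> 0 <= s <= 1 ->
  ufin (s *: y + (1 - s) *: z) /\
  usum (s *: y + (1 - s) *: z) <= s * usum y + (1 - s) * usum z.
Proof.
move=> yf zf s01.
have h i : (u i (submxcol (s *: y + (1 - s) *: z) i) <=
    (s * fine (u i (submxcol y i)) + (1 - s) * fine (u i (submxcol z i)))%:E)%E.
  by rewrite submxcolD !submxcolZ pcc_convex //; exact: u_pcc.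
have hf : ufin (s *: y + (1 - s) *: z).
  by move=> i; rewrite (le_lt_trans (h i)) // ltry.
split=> //; rewrite /usum !mulr_sumr -big_split ler_sum //= => i _.
by rewrite -lee_fin fineK ?h // ufin_fin_num.
Qed.

Lemma fobj_convex s y z : ufin y -> ufin z -> 0 <= s <= 1 ->
  fobj (s *: y + (1 - s) *: z) <= s * fobj y + (1 - s) * fobj z.
Proof.
move=> yf zf s01; have [_ [_ cf] _] := conv.
have [_] := ufin_convex yf zf s01.
have := convex_functionP y z cf s01.
rewrite /fobj; lra.
Qed.

Section Step.
Context (Phat_psd : psd Phat) (Phat_diag : block_diagonal Phat).
Context (xs : 'cV[R]_(\sum_i d i)) (Xxs : prodset X xs) (xs_fin : ufin xs).
Context (I : {set 'I_N}) (z zp : 'cV[R]_(\sum_i d i)) (r l : 'cV[R]_m).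
Context (zp_fixed : forall i, i \notin I -> submxcol zp i = submxcol z i).
Context (zp_argmin : is_argmin (prodset_sub X (I := I))
  (subproblem f u A Phat rhox z r l) (subvec I zp)).

Lemma step_mask : blockmask I (zp - z) = zp - z.
Proof.
by apply: blockmask_id => i /zp_fixed h; rewrite submxcolD submxcolN h subrr.
Qed.

Lemma step_in_X : prodset X z -> prodset X zp.
Proof.
rewrite /prodset /= => Xz i; have [iI|/zp_fixed -> //] := boolP (i \in I).
by have [/prodset_sub_subvec h _] := zp_argmin; exact: h.
Qed.

(** The sub-vector of [xs] is a feasible competitor with finite value, so the minimal value is
    finite as well. *)
Lemma step_ufin : ufin z -> ufin zp.
Proof.
move=> zf i; have [iI|/zp_fixed -> //] := boolP (i \in I).
have Xsub : prodset_sub X (subvec I xs).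
  by apply/prodset_sub_subvec => j _; exact: Xxs.
have [_ /(_ _ Xsub)] := zp_argmin.
rewrite !subproblem_subvec // (sum_u_fine (z := xs)) // => h.
apply: (@sum_u_lty (mem I) (fun i => submxcol zp i)) => //.
have := le_lt_trans h (ltry _); rewrite addeC; exact: EFin_adde_lty.
Qed.

(** The minimizer is compared with the points of the segment towards [xs]. Convexity bounds the
    nonsmooth part linearly in [s], the rest is linear plus [s^2] times a nonnegative constant, and
    [linear_term_ge0] isolates the linear coefficient. *)
Lemma step_variational_inequality : ufin z ->
  0 <= dotv (grad f z - A^T *m l + rhox *: (A^T *m r)) (blockmask I (xs - zp))
     + (\sum_(i in I) fine (u i (submxcol xs i)) -
        \sum_(i in I) fine (u i (submxcol zp i)))
     + dotv (Phat *m (zp - z)) (blockmask I (xs - zp)).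
Proof.
move=> zf; have zpf := step_ufin zf.
set e := blockmask I (xs - zp); set w := zp - z.
apply: (@linear_term_ge0 _ _ (2^-1 * wnorm2 Phat e)).
  by rewrite mulr_ge0 ?invr_ge0 //; case: Phat_psd => _; exact.
move=> s /andP[s0 s1].
have s01 : 0 <= s <= 1 by rewrite !ltW.
pose y := s *: xs + (1 - s) *: zp.
have ye : y = zp + s *: (xs - zp).
  by rewrite /y scalerBl scale1r scalerBr addrCA.
have [zpX /(_ (subvec I y))] := zp_argmin.
have /[swap] /[apply] : prodset_sub X (subvec I y).
  apply/prodset_sub_subvec => i iI; rewrite submxcolD !submxcolZ.
  by apply: prodset_convex => //; exact: (prodset_sub_subvec _ _ _).1 zpX i iI.
rewrite !subproblem_subvec // (sum_u_fine (z := zp)) //.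
have hy : (\sum_(i in I) u i (submxcol y i) <=
    (s * \sum_(i in I) fine (u i (submxcol xs i)) +
     (1 - s) * \sum_(i in I) fine (u i (submxcol zp i)))%:E)%E.
  rewrite !mulr_sumr -big_split -sumEFin lee_sum //= => i iI.
  by rewrite submxcolD !submxcolZ pcc_convex //; exact: u_pcc.
have yz : blockmask I (y - z) = w + s *: e.
  rewrite ye addrAC blockmaskD blockmaskZ step_mask //.
have yI : blockmask I y = blockmask I zp + s *: e.
  by rewrite ye blockmaskD blockmaskZ.
move=> /le_trans /(_ (leeD2r _ hy)).
rewrite -!EFinD lee_fin yz yI step_mask -/w.
case: Phat_psd => Ps _.
rewrite wnorm2D // wnorm2Z !mulmxDr -!scalemxAr !dotvEl !dotv_mull.
lra.
Qed.

(** The partial Lipschitz bound applies because the step is supported on [I]. The Loewner bound then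
    replaces [Lf |w|^2] by the squared proximal norm of the step [w], which is the [Phat] term minus
    [rhox |A w|^2]. *)
Lemma step_descent n Lf : #|I| = n -> lipschitz_partial_gradient n Lf f ->
  loewner_ge (prox_matrix Phat rhox A I) Lf%:M ->
  f zp - f z <= dotv (grad f z) (zp - z) + 2^-1 *
    (wnorm2 Phat (zp - z) - rhox * dotv (A *m (zp - z)) (A *m (zp - z))).
Proof.
move=> cI lip [_ /(_ (subvec I (zp - z)))].
rewrite wnorm2B wnorm2_scalar /prox_matrix wnorm2B wnorm2_subdiag //.
rewrite wnorm2_gram subcols_subvec step_mask dotv_subvec_mask step_mask.
move=> hP; set w := zp - z in hP *.
have [_ [df _] _] := conv.
have := @descent _ _ f z w (Lf * dotv w w) df.
rewrite (_ : z + w = zp) ?subrKC // => /(_ _) hd.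
suff : f zp - f z <= dotv (grad f z) w + Lf * dotv w w / 2 by lra.
apply: hd => s /andP[s0 s1].
have wI : blockmask I w = w := step_mask.
have -> : dotv w w = enorm (subvec I w) ^+ 2.
  by rewrite enorm2E dotv_subvec_mask wI.
rewrite -[X in dotv _ X <= _]wI -dotv_subvec_mask.
apply: (le_trans (dotv_le_enorm _ _)).
have := lip I cI z (s *: w); rewrite blockmaskZ wI.
rewrite /subgrad_at -subvecN -subvecD subvecZ enormZ ?(ltW s0) // => h.
have := ler_wpM2r (enorm_ge0 (subvec I w)) h; rewrite expr2; lra.
Qed.

(** Sum of the descent bound and the variational inequality. The cross term in [Phat] becomes a
    difference of squared distances to [xs] by the three-point identity. *)
Lemma step_energy n Lf : #|I| = n -> lipschitz_partial_gradient n Lf f ->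
  loewner_ge (prox_matrix Phat rhox A I) Lf%:M -> ufin z ->
  let w := A *m (zp - z) in
  fobj zp - fobj z + \sum_(i in I) block_gap xs z r l i
  + rhox * dotv r w - dotv l w + rhox / 2 * dotv w w
  + 2^-1 * (wnorm2 Phat (zp - xs) - wnorm2 Phat (z - xs)) <= 0.
Proof.
move=> cI lip hP zf /=.
have hd := step_descent cI lip hP.
have hv := step_variational_inequality zf.
rewrite sum_block_gap_in /fobj.
have -> : usum zp = usum z + (\sum_(i in I) fine (u i (submxcol zp i)) -
    \sum_(i in I) fine (u i (submxcol z i))).
  rewrite /usum (bigID (mem I)) [in RHS](bigID (mem I)) /=.
  rewrite (eq_bigr (fun i => fine (u i (submxcol z i)))
    (P := fun i => i \notin I)); first by lra.
  by move=> i /zp_fixed ->.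
have eP : dotv (Phat *m (zp - z)) (blockmask I (xs - zp)) =
    dotv (Phat *m (zp - z)) (xs - zp).
  rewrite -dotv_blockmask_sym blockmask_block_diagonal //; exact: step_mask.
rewrite eP in hv.
have -> : wnorm2 Phat (z - xs) = wnorm2 Phat (zp - z) +
    2 * dotv (Phat *m (zp - z)) (xs - zp) + wnorm2 Phat (zp - xs).
  rewrite -(wnorm2N Phat (zp - xs)) opprB -wnorm2D; last by case: Phat_psd.
  rewrite -wnorm2N; congr wnorm2.
  by rewrite opprB [RHS]addrC addrA subrK.
have -> : blockmask I (z - xs) = - (zp - z) - blockmask I (xs - zp).
  apply: (addIr (blockmask I (xs - zp))).
  rewrite subrK -blockmaskD addrA subrK -(opprB zp z) -scaleN1r.
  by rewrite blockmaskZ step_mask.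
move: (blockmask I (xs - zp)) hv => e hv.
rewrite !dotv_mull in hd hv *; rewrite !dotvEl in hd hv *.
lra.
Qed.

End Step.

End OneStep.

(** * Energy inequality and lower bounds along a fixed trajectory *)

Section Trajectory.
Context {R : realType} {N : nat} {d : 'I_N -> nat} {m : nat}.
Context (f : 'cV[R]_(\sum_i d i) -> R) (u : forall i, 'cV[R]_(d i) -> \bar R).
Context (X : forall i, set 'cV[R]_(d i)).
Context (A : 'M[R]_(m, \sum_i d i)) (b : 'cV[R]_m).
Context (Phat : 'M[R]_(\sum_i d i)) (rhox rho theta : R).
Context (xs : 'cV[R]_(\sum_i d i)).
Arguments u : clear implicits.
Arguments X : clear implicits.

(** With [r] the residual of [z], this is the Lagrangian at [z] minus the Lagrangian at [xs], both
    with multiplier [l], because [xs] has zero residual. *)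
Definition lagr_gap z (r l : 'cV[R]_m) : R := fobj f u z - fobj f u xs - dotv r l.

(* The Lyapunov function: in conditional expectation it is nonincreasing. *)
Definition energy (x : nat -> 'cV[R]_(\sum_i d i)) (r l : nat -> 'cV[R]_m) k : R :=
  (1 - theta) * lagr_gap (x k) (r k) (l k)
  + theta * \sum_(1 <= j < k.+1) lagr_gap (x j) (r j) (l j)
  + (1 - theta) * rhox * dotv (r k) (r k)
  + 2^-1 * wnorm2 (Phat - rhox *: (A^T *m A)) (x k - xs).

(** The last point is a separate argument so that an induction on [t] can keep it fixed; the ergodic
    average is the case [y = x t.+1]. *)
Definition weighted_average (y : 'cV[R]_(\sum_i d i)) x t :=
  (1 + theta * t%:R)^-1 *: (y + theta *: \sum_(1 <= k < t.+1) x k).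

Context (conv : convexity f u X) (theta0 : 0 < theta).
Context (rhox0 : 0 < rhox) (rhoE : rho = theta * rhox).
Context (Phat_psd : psd Phat) (Phat_diag : block_diagonal Phat).
Context (Xxs : prodset X xs) (xs_fin : ufin u xs) (Axs : A *m xs = b).

Lemma weight_gt0 t : 0 < 1 + theta * t%:R.
Proof. by rewrite ltr_pwDl // mulr_ge0 // ltW. Qed.

Lemma weighted_averageS y x t (s := (1 + theta * t%:R) / (1 + theta * t.+1%:R)) :
  0 <= s <= 1 /\
  weighted_average y x t.+1 =
    s *: weighted_average y x t + (1 - s) *: x t.+1.
Proof.
have w0 := weight_gt0 t; have w1 := weight_gt0 t.+1.
have sE : s * (1 + theta * t.+1%:R) = 1 + theta * t%:R by rewrite /s divfK // gt_eqF.
have E : (1 + theta * t.+1%:R) - (1 + theta * t%:R) = theta.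
  by rewrite -natr1; ring.
split.
  rewrite /s divr_ge0 ?(ltW w0) ?(ltW w1) //= ler_pdivrMr // mul1r.
  by rewrite -subr_ge0 E ltW.
have e1 : s / (1 + theta * t%:R) = (1 + theta * t.+1%:R)^-1.
  by rewrite /s mulrAC divff ?mul1r // gt_eqF.
have e2 : 1 - s = (1 + theta * t.+1%:R)^-1 * theta.
  apply: (mulfI (lt0r_neq0 w1)).
  by rewrite mulrBr mulr1 [_ * s]mulrC sE E mulrA divff ?mul1r // gt_eqF.
rewrite /weighted_average big_nat_recr //= scalerA e1 e2 -scalerA -scalerDr.
by rewrite -addrA -scalerDr.
Qed.

(** Jensen's inequality by induction on [t]: each new average is a convex combination of the
    previous one and the next iterate. *)
Lemma weighted_average_jensen y x t : ufin u y -> prodset X y ->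
  (forall k, ufin u (x k)) -> (forall k, prodset X (x k)) ->
  [/\ ufin u (weighted_average y x t), prodset X (weighted_average y x t) &
   (1 + theta * t%:R) * fobj f u (weighted_average y x t) <=
   fobj f u y + theta * \sum_(1 <= k < t.+1) fobj f u (x k)].
Proof.
move=> yf yX xf xX; elim: t => [|t [IHf IHX IH]].
  rewrite /weighted_average !big_geq // scaler0 addr0 !mulr0 addr0 invr1 scale1r.
  by rewrite mul1r addr0.
have [s01 ->] := weighted_averageS y x t.
set s := _ / _ in s01 *; set z := weighted_average y x t in IHf IHX IH *.
have [zf _] := ufin_convex conv IHf (xf t.+1) s01.
split=> //.
  move=> i; rewrite submxcolD (submxcolZ s z) (submxcolZ _ (x t.+1)).
  apply: (prodset_convex conv) => //.
  exact: (xX t.+1 i).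
have h := fobj_convex conv IHf (xf t.+1) s01.
have w1 := weight_gt0 t.+1.
have sE : s * (1 + theta * t.+1%:R) = 1 + theta * t%:R by rewrite /s divfK // gt_eqF.
have E : (1 + theta * t.+1%:R) - (1 + theta * t%:R) = theta.
  by rewrite -natr1; ring.
clearbody s; apply: le_trans (ler_wpM2l (ltW w1) h) _.
rewrite mulrDr !mulrA [_ * s]mulrC sE mulrBr mulr1 [_ * s]mulrC sE E.
rewrite big_nat_recr //=; move: IH; lra.
Qed.

Context (I : nat -> {set 'I_N}) (x : nat -> 'cV[R]_(\sum_i d i)).
Context (r l : nat -> 'cV[R]_m) (n : nat) (Lf : R).
Context (I_card : forall k, #|I k| = n).
Context (lip : lipschitz_partial_gradient n Lf f).
Context (prox_ge : forall k, loewner_ge (prox_matrix Phat rhox A (I k)) Lf%:M).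
Context (x0f : ufin u (x 0%N)) (x0X : prodset X (x 0%N)).
Context (l0 : l 0%N = 0) (r0 : r 0%N = A *m x 0%N - b).
Context (x_fixed : forall k i, i \notin I k ->
  submxcol (x k.+1) i = submxcol (x k) i).
Context (x_argmin : forall k, is_argmin (prodset_sub X (I := I k))
  (subproblem f u A Phat rhox (x k) (r k) (l k)) (subvec (I k) (x k.+1))).
Context (rS : forall k, r k.+1 = r k +
  subcols A (I k) *m (subvec (I k) (x k.+1) - subvec (I k) (x k))).
Context (lS : forall k, l k.+1 = l k - rho *: r k.+1).

Lemma iterate_ufin k : ufin u (x k).
Proof.
elim: k => // k IH.
exact: (step_ufin conv Phat_diag Xxs xs_fin (@x_fixed k) (x_argmin k)).
Qed.

Lemma iterate_X k : prodset X (x k).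
Proof. elim: k => // k IH; exact: (step_in_X (@x_fixed k) (x_argmin k)). Qed.

Lemma residualS k : r k.+1 = r k + A *m (x k.+1 - x k).
Proof.
by rewrite rS -subvecN -subvecD subcols_subvec (step_mask (@x_fixed k)).
Qed.

Lemma residualE k : r k = A *m x k - b.
Proof. by elim: k => // k IH; rewrite residualS IH mulmxBr addrC addrA subrK. Qed.

Lemma residual_diff k : A *m (x k - xs) = r k.
Proof. by rewrite residualE mulmxBr Axs. Qed.

(** By the gradient inequality, the full gap sum is at least [lagr_gap] plus [rhox |r_k|^2]. Adding
    [theta] times this to the one-step inequality, with [rho = theta * rhox], produces exactly the
    increments of the energy. *)
Lemma energy_step k :
  energy x r l k.+1 <= energy x r l k
    - \sum_(i in I k) block_gap f u A rhox xs (x k) (r k) (l k) i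
    + theta * \sum_i block_gap f u A rhox xs (x k) (r k) (l k) i.
Proof.
have := step_energy conv Phat_psd Phat_diag Xxs xs_fin (@x_fixed k) (x_argmin k)
  (I_card k) lip (prox_ge k) (iterate_ufin k).
set h := \sum_(i in I k) _ => /=.
rewrite sum_block_gap /energy [X in theta * X]big_nat_recr //=.
rewrite !wnorm2B !wnorm2_gram !residual_diff /lagr_gap.
have hg : fobj f u (x k) - fobj f u xs <=
    dotv (grad f (x k)) (x k - xs) + (usum u (x k) - usum u xs).
  have [_ [df cf] _] := conv.
  have := convex_gradient_le xs (df (x k)) cf.
  rewrite /fobj -[xs - _]opprB dotvNr; lra.
rewrite !dotvDl dotvNl dotvZl -!dotv_mull residual_diff.
have -> : A *m (x k.+1 - x k) = r k.+1 - r k by rewrite residualS [RHS]addrC addKr.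
rewrite lS !dotvEl (dotvC (r k.+1) (r k)) (dotvC (l k)) (dotvC (l k)).
rewrite rhoE.
set S := \sum_(1 <= j < k.+1) _.
rewrite dotvDr dotvNr in hg; have := ler_wpM2l (ltW theta0) hg.
lra.
Qed.

(* Writing r_j = (l_{j-1} - l_j) / rho makes - <r_j, l_j - mu> telescope. *)
Lemma lagr_gap_sum_ge mu t :
  \sum_(1 <= j < t.+1) (fobj f u (x j) - fobj f u xs - dotv (r j) mu) +
  (2 * rho)^-1 * (dotv (l t - mu) (l t - mu) - dotv mu mu) <=
  \sum_(1 <= j < t.+1) lagr_gap (x j) (r j) (l j).
Proof.
have rho0 : 0 < rho by rewrite rhoE mulr_gt0.
elim: t => [|t IH].
  by rewrite !big_geq // l0 sub0r dotvNl dotvNr opprK subrr mulr0 addr0.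
rewrite big_nat_recr //= [X in _ <= X]big_nat_recr //= /lagr_gap.
have -> : l t.+1 - mu = (l t - mu) - rho *: r t.+1 by rewrite lS addrAC.
have [q qE] : exists q, q = l t - mu by exists (l t - mu).
have lE : l t = q + mu by rewrite qE subrK.
rewrite -qE in IH *.
have -> : dotv (q - rho *: r t.+1) (q - rho *: r t.+1) =
    dotv q q - 2 * rho * dotv (r t.+1) q + rho ^+ 2 * dotv (r t.+1) (r t.+1).
  by rewrite !dotvEl (dotvC q); ring.
have -> : dotv (r t.+1) (l t.+1) =
    dotv (r t.+1) mu + dotv (r t.+1) q - rho * dotv (r t.+1) (r t.+1).
  by rewrite lS lE !dotvEl; ring.
have -> : forall c e : R, (2 * rho)^-1 *
    (dotv q q - 2 * rho * c + rho ^+ 2 * e - dotv mu mu) =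
    (2 * rho)^-1 * (dotv q q - dotv mu mu) - c + rho / 2 * e.
  by move=> c e; field; rewrite gt_eqF.
have : 0 <= rho / 2 * dotv (r t.+1) (r t.+1).
  by rewrite mulr_ge0 ?dotv_ge0 // divr_ge0 // ltW.
move: IH; rewrite /lagr_gap.
lra.
Qed.

(** The residual is affine in the point, and the weights of the average sum to one. *)
Lemma weighted_average_residual t :
  (1 + theta * t%:R) *: (A *m weighted_average (x t.+1) x t - b) =
  r t.+1 + theta *: \sum_(1 <= j < t.+1) r j.
Proof.
rewrite -Axs -mulmxBr scalemxAr /weighted_average scalerBr scalerA.
rewrite mulfV ?gt_eqF ?weight_gt0 // scale1r.
have -> : \sum_(1 <= j < t.+1) r j =
    A *m \sum_(1 <= j < t.+1) x j - t%:R *: (A *m xs).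
  rewrite mulmx_sumr (eq_bigr (fun j => A *m x j - A *m xs)) => [|j _].
    by rewrite sumrB sumr_const_nat subSS subn0 scaler_nat.
  by rewrite -residual_diff mulmxBr.
rewrite -residual_diff !mulmxBr mulmxDr scalerDl scale1r mulmxDr -!scalemxAr.
rewrite scalerBr scalerA opprD !addrA; congr (_ - _).
by rewrite addrAC.
Qed.

(** Jensen's inequality and the telescoped multiplier bound reduce the claim to the nonnegativity of
    a [Phat] term and of a completed square. *)
Lemma energy_lower t mu (xh := weighted_average (x t.+1) x t) :
  (1 + theta * t%:R) * (fobj f u xh - fobj f u xs - dotv (A *m xh - b) mu) <=
  energy x r l t.+1 + (2 * rhox)^-1 * dotv mu mu.
Proof.
have [_ _] := weighted_average_jensen t (iterate_ufin t.+1) (iterate_X t.+1)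
  iterate_ufin iterate_X.
rewrite -/xh => hJ.
have hR : (1 + theta * t%:R) * dotv (A *m xh - b) mu =
    dotv (r t.+1) mu + theta * \sum_(1 <= j < t.+1) dotv (r j) mu.
  rewrite -dotvZl weighted_average_residual dotvDl dotvZl; congr (_ + _ * _).
  exact: (big_morph (fun y => dotv y mu) (fun y z => dotvDl mu y z) (dotv0l mu)).
have hS := lagr_gap_sum_ge mu t.
have hT : \sum_(1 <= j < t.+1) (fobj f u (x j) - fobj f u xs - dotv (r j) mu) =
    \sum_(1 <= j < t.+1) fobj f u (x j) - t%:R * fobj f u xs -
    \sum_(1 <= j < t.+1) dotv (r j) mu.
  by rewrite !sumrB sumr_const_nat subSS subn0 mulr_natl.
rewrite hT in hS.
rewrite /energy big_nat_recr //= wnorm2B wnorm2_gram residual_diff.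
move: hS; set S := \sum_(1 <= j < t.+1) lagr_gap _ _ _ => hS.
rewrite /lagr_gap.
(* This square absorbs the cross term between [r t.+1] and [l t - mu]. The residual terms of the
   energy add up to [rhox / 2 |r_(t+1)|^2] whatever [theta] is, because [rho = theta * rhox]. *)
have hq : 0 <= (2 * rhox)^-1 *
    dotv (l t - mu - rhox *: r t.+1) (l t - mu - rhox *: r t.+1).
  by rewrite mulr_ge0 ?dotv_ge0 // invr_ge0 mulr_ge0 // ltW.
have [q qE] : exists q, q = l t - mu by exists (l t - mu).
have lE : l t = q + mu by rewrite qE subrK.
rewrite -qE in hS hq.
have := ler_wpM2l (ltW theta0) hS.
have hw : 0 <= wnorm2 Phat (x t.+1 - xs) by case: Phat_psd => _; exact.
have -> : dotv (r t.+1) (l t.+1) =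
    dotv (r t.+1) mu + dotv (r t.+1) q - rho * dotv (r t.+1) (r t.+1).
  by rewrite lS lE !dotvEl; ring.
have eq1 : (2 * rhox)^-1 *
    dotv (q - rhox *: r t.+1) (q - rhox *: r t.+1) =
    (2 * rhox)^-1 * dotv q q - dotv (r t.+1) q
    + rhox / 2 * dotv (r t.+1) (r t.+1).
  by rewrite !dotvEl (dotvC q); field; rewrite gt_eqF.
rewrite eq1 in hq.
have -> : forall c : R, theta * (c + (2 * rho)^-1 * (dotv q q - dotv mu mu)) =
    theta * c + (2 * rhox)^-1 * dotv q q - (2 * rhox)^-1 * dotv mu mu.
  by move=> c; rewrite rhoE; field; rewrite !gt_eqF.
rewrite [(1 + theta * t%:R) * (_ - _)]mulrBr hR.
move: hJ hw hq; rewrite rhoE.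
lra.
Qed.

Context (ls : 'cV[R]_m).
Context (xs_opt : forall z, prodset X z -> ufin u z ->
  0 <= fobj f u z - fobj f u xs - dotv (A *m z - b) ls).

Lemma energy_bound t (xh := weighted_average (x t.+1) x t)
    (c := Num.max ((1 + enorm ls) ^+ 2) (4 * enorm ls ^+ 2) / (2 * rhox)) :
  (1 + theta * t%:R) * `|fobj f u xh - fobj f u xs| <= energy x r l t.+1 + c /\
  (1 + theta * t%:R) * enorm (A *m xh - b) <= energy x r l t.+1 + c.
Proof.
have [xf xX _] := weighted_average_jensen t (iterate_ufin t.+1) (iterate_X t.+1)
  iterate_ufin iterate_X.
have := xs_opt xX xf; rewrite -/xh.
have ls0 := enorm_ge0 ls.
(* The first entry of the maximum serves for the residual norm, the second for the absolute
   objective error. Squaring is monotone on nonnegative numbers, hence [c = g^2 / (2 rhox)]. *)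
pose g := Num.max (1 + enorm ls) (2 * enorm ls).
have g1 : 1 + enorm ls <= g by rewrite le_max lexx.
have g2 : 2 * enorm ls <= g by rewrite le_max lexx orbT.
have cE : c = (2 * rhox)^-1 * g ^+ 2.
  rewrite /c mulrC; congr (_ * _); rewrite /g.
  case: (leP (1 + enorm ls) (2 * enorm ls)) => h.
    by rewrite max_r ?exprMn ?expr2; nra.
  by rewrite max_l ?exprMn ?expr2; nra.
set res := A *m xh - b; set e := enorm res.
have e0 : 0 <= e by exact: enorm_ge0.
have hls : - (enorm ls * e) <= dotv res ls.
  by rewrite -[dotv _ _]opprK lerN2 -dotvNl (le_trans (dotv_le_enorm _ _)) //
    enormN mulrC.
(* A multiplier of norm at most [g] with [- <res, mu> = g |res|]. If [e = 0], the convention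
   [g / 0 = 0] makes it zero. *)
pose mu := - (g / e) *: res.
have hmu : dotv res mu = - (g * e).
  rewrite /mu dotvZr -enorm2E -/e expr2.
  by have [->|en0] := eqVneq e 0; [rewrite !mulr0 oppr0|field].
have hmu2 : (2 * rhox)^-1 * dotv mu mu <= (2 * rhox)^-1 * g ^+ 2.
  apply: ler_wpM2l; first by rewrite invr_ge0 mulr_ge0 // ltW.
  rewrite /mu dotvZr dotvZl -enorm2E -/e.
  have [->|en0] := eqVneq e 0; first by rewrite [0 ^+ 2]expr2 !mulr0 sqr_ge0.
  by rewrite le_eqVlt; apply/orP; left; apply/eqP; field.
have := energy_lower t mu; rewrite /= -/xh -/res hmu cE => hV hopt.
set D := fobj f u xh - fobj f u xs in hV hopt *.
have w0 := weight_gt0 t.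
(* Optimality of [xs] gives [D >= - |ls| e]; then [g >= 2 |ls|] yields this bound and
   [g >= 1 + |ls|] the next one. *)
have k1 : `|D| <= D + g * e by rewrite ler_norml; apply/andP; split; nra.
have k2 : e <= D + g * e by nra.
have := ler_wpM2l (ltW w0) k1; have := ler_wpM2l (ltW w0) k2.
lra.
Qed.

End Trajectory.

(** * Measurability of functions of random vectors *)

Section VectorMeasurability.
Context {R : realType} {disp : measure_display} {T : measurableType disp}.

Lemma measurable_sublevels (g : T -> R) :
  (forall c, measurable [set w | g w <= c]) -> measurable_fun setT g.
Proof.
move=> h mT; apply: (measurability _ (RGenOInfty.measurableE R)) => //.
move=> /= _ [_ [c ->] <-]; rewrite setTI.
rewrite (_ : _ @^-1` _ = ~` [set w | g w <= c]); first exact: measurableC.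
apply/seteqP; split => w /=; rewrite in_itv /= andbT ltNge.
  by move/negP.
by move=> gc; apply/negP.
Qed.

Context {n : nat} (y : T -> 'cV[R]_n).
Context (my : forall c, measurable_fun setT (fun w => y w c ord0)).

(** The open complement is a countable union of rational boxes, and a box is a finite intersection
    of coordinate conditions. Boxes not contained in the complement are replaced by the empty
    set. *)
Lemma measurable_vec_closed (C : set 'cV[R]_n) :
  closed C -> measurable (y @^-1` C).
Proof.
move=> cC; rewrite -[X in measurable X]setCK; apply: measurableC.
have oC : open (~` C) by exact: closed_openC.
pose B (qk : {ffun 'I_n -> rat} * nat) : set 'cV[R]_n :=
  [set z | forall c, ball (ratr (qk.1 c) : R) qk.2.+1%:R^-1 (z c ord0)].
have -> : ~` (y @^-1` C) =
    \bigcup_qk (if `[< B qk `<=` ~` C >] then y @^-1` B qk else set0).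
  apply/seteqP; split=> [w /= Cw|w [qk _]]; last first.
    by case: asboolP => // h; exact: h.
  have /nbhs_ballP[e /= e0 eC] := open_nbhs_nbhs (conj oC Cw).
  have e20 : 0 < e / 2 by rewrite divr_gt0.
  (* A box of radius below [e / 2] that contains [y w] lies in the ball of radius [e] around it. *)
  have [k] := ltr_add_invr e20; rewrite add0r => ke.
  have k0 : 0 < k.+1%:R^-1 :> R by rewrite invr_gt0.
  have hq c : {q : rat | ball (ratr q : R) k.+1%:R^-1 (y w c ord0)}.
    apply: cid.
    have /rat_in_itvoo[q] : y w c ord0 - k.+1%:R^-1 < y w c ord0 + k.+1%:R^-1.
      by rewrite ltrD2l (lt_trans _ k0) // oppr_lt0.
    rewrite in_itv /= => /andP[q1 q2]; exists q.
    rewrite /ball /= ltr_norml; move: (k.+1%:R^-1) q1 q2 => e1 q1 q2; lra.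
  exists ([ffun c => sval (hq c)], k) => //.
  case: asboolP => [_ c|] /=; first by rewrite ffunE; exact: svalP (hq c).
  apply; move=> z Bz; apply: eC; split=> // i j; rewrite (ord1 j).
  have := Bz i; rewrite /= ffunE => h1; have h2 := svalP (hq i).
  have := ball_triangle (ball_sym h2) h1.
  by apply: le_ball; rewrite (splitr e) lerD // ltW.
apply: countable_bigcupT_measurable => [|qk]; first exact: countableP.
case: asboolP => // _.
have -> : y @^-1` B qk =
    \bigcap_(c in setT) [set w | ball (ratr (qk.1 c) : R) qk.2.+1%:R^-1 (y w c ord0)].
  by apply/seteqP; split => w h c; [move=> _; exact: h|exact: h].
apply: fin_bigcap_measurable => [|c _]; first exact: finite_finset.
have := my c measurableT; rewrite -[X in measurable X]setTI; apply.
by rewrite ball_itv; exact: measurable_itv.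
Qed.

Lemma measurable_comp_continuous (f : 'cV[R]_n -> R) :
  continuous f -> measurable_fun setT (fun w => f (y w)).
Proof.
move=> cf; apply: measurable_sublevels => c.
apply: (measurable_vec_closed (C := [set z | f z <= c])).
apply: (@preimage_closed _ _ f [set a | a <= c]) => [z _|]; first exact: cf.
exact: closed_le.
Qed.

(** Such a function may be discontinuous, but its sublevel sets are closed. *)
Lemma measurable_comp_pcc (u : 'cV[R]_n -> \bar R) : proper_closed_convex u ->
  (forall w, (u (y w) < +oo)%E) -> measurable_fun setT (fun w => fine (u (y w))).
Proof.
move=> u_pcc uf; apply: measurable_sublevels => c.
have -> : [set w | fine (u (y w)) <= c] = y @^-1` [set z | (u z <= c%:E)%E].
  apply/seteqP; split=> w /=.
    by rewrite -lee_fin fineK // (pcc_fin_num u_pcc).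
  by rewrite -[X in (X <= _)%E -> _]fineK ?lee_fin // (pcc_fin_num u_pcc).
exact/measurable_vec_closed/pcc_closed_sublevel.
Qed.

End VectorMeasurability.

Section VectorOperations.
Context {R : realType} {disp : measure_display} {T : measurableType disp}.

(** A partial derivative is a pointwise limit of difference quotients, which are measurable by
    continuity of [f]; continuity of the gradient is not involved. *)
Lemma measurable_grad n (f : 'cV[R]_n -> R) (y : T -> 'cV[R]_n) c :
  (forall c, measurable_fun setT (fun w => y w c ord0)) ->
  (forall z, differentiable f z) ->
  measurable_fun setT (fun w => grad f (y w) c ord0).
Proof.
move=> my df; pose v : 'cV[R]_n := delta_mx c ord0.
have cf : continuous f by move=> z; exact: differentiable_continuous.
apply: (measurable_fun_cvg (h := fun k w =>
  k.+1%:R * (f (k.+1%:R^-1 *: v + y w) - f (y w)))) => [k|w _].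
  apply: measurable_funM => //; apply: measurable_funB; last first.
    exact: measurable_comp_continuous.
  apply: (measurable_comp_continuous (y := fun w => k.+1%:R^-1 *: v + y w)) => // j.
  under eq_fun do rewrite mxE.
  by apply: measurable_funD.
rewrite /grad mxE; apply: derive_cvg_seq; exact: diff_derivable.
Qed.

Lemma measurable_dotv n (y z : T -> 'cV[R]_n) :
  (forall c, measurable_fun setT (fun w => y w c ord0)) ->
  (forall c, measurable_fun setT (fun w => z w c ord0)) ->
  measurable_fun setT (fun w => dotv (y w) (z w)).
Proof.
move=> my mz; under eq_fun do rewrite dotvE.
by apply: measurable_sum => c; exact: measurable_funM.
Qed.

Lemma measurable_mulmx m n (B : 'M[R]_(m, n)) (y : T -> 'cV[R]_n) c :
  (forall c, measurable_fun setT (fun w => y w c ord0)) ->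
  measurable_fun setT (fun w => (B *m y w) c ord0).
Proof.
move=> my; under eq_fun do rewrite mxE.
by apply: measurable_sum => j; exact: measurable_funM.
Qed.

Lemma measurable_enorm n (y : T -> 'cV[R]_n) :
  (forall c, measurable_fun setT (fun w => y w c ord0)) ->
  measurable_fun setT (fun w => enorm (y w)).
Proof.
move=> my; apply: (measurableT_comp (f := @Num.sqrt R)).
  exact: continuous_measurable_fun (@sqrt_continuous R).
exact: measurable_dotv.
Qed.

End VectorOperations.

(** * Averaging over an independent uniform draw *)

Section RandomDraw.
Context {R : realType} {disp : measure_display} {T : measurableType disp}.
Context (P : probability T R).

(** Both sides integrate one function of a real variable against image measures under [g]: that of
    [P] restricted to [D], and [p] times that of [P]. The hypothesis says that these agree on
    measurable sets. *)
Lemma integral_indep (D : set T) (g : T -> R) (p : R) : measurable D ->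
  measurable_fun setT g -> (forall w, 0 <= g w) -> 0 <= p ->
  (forall B, measurable B -> P (D `&` g @^-1` B) = (p%:E * P (g @^-1` B))%E) ->
  (\int[P]_(w in D) (g w)%:E = p%:E * \int[P]_w (g w)%:E)%E.
Proof.
move=> mD mg g0 p0 indep.
have mgE : measurable_fun setT (fun w => (g w)%:E) by exact/measurable_EFinP.
(* Truncation makes the integrand nonnegative on the whole line while leaving it unchanged on the
   values of [g]. *)
pose phi (a : R) := (Num.max a 0)%:E.
have mphi : measurable_fun setT phi.
  by apply/measurable_EFinP; exact: measurable_maxr.
have phi0 a : (0 <= phi a)%E by rewrite lee_fin le_max lexx orbT.
have phig : (fun w => (g w)%:E) = phi \o g.
  by apply/funext => w; rewrite /phi /= max_l.
pose PD := mrestr P mD.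
have -> : (\int[P]_(w in D) (g w)%:E = \int[PD]_w (g w)%:E)%E.
  rewrite (eq_measure_integral PD); last first.
    by move=> A mA AD; rewrite /= /mrestr setIidl.
  rewrite (ge0_negligible_integral (mu := PD) (D := setT) (N := ~` D)) //.
  - by rewrite setTD setCK.
  - exact: measurableC.
  - by move=> w _; rewrite lee_fin.
  - by rewrite /= /mrestr setICl measure0.
rewrite phig.
have h (mu : {measure set T -> \bar R}) :
    (\int[mu]_w (phi \o g) w = \int[pushforward mu g]_a phi a)%E.
  by rewrite (ge0_integral_pushforward mg).
rewrite !h.
rewrite -[p]/((NngNum p0)%:num) -ge0_integral_mscale //.
apply: eq_measure_integral => B mB _.
by rewrite /= /mscale /= /pushforward /= /mrestr setIC indep.
Qed.

Context {K : finType} (J : T -> K) (Q : pred K) (p : R).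
Context (G : K -> T -> R) (V V' : T -> R).

(* Since [J] is independent of every [G s], [V] is the conditional expectation
   of [fun w => G (J w) w]. *)
Lemma integral_draw_le : 0 < p ->
  (forall s, measurable (J @^-1` [set s])) -> (forall w, Q (J w)) ->
  (forall s, Q s -> measurable_fun setT (G s)) ->
  (forall s B, Q s -> measurable B ->
    P (J @^-1` [set s] `&` G s @^-1` B) = (p%:E * P (G s @^-1` B))%E) ->
  measurable_fun setT V -> measurable_fun setT V' ->
  (forall w, 0 <= V' w <= G (J w) w) ->
  (forall w, p * \sum_(s | Q s) G s w = V w) ->
  (exists w, 0 <= V w) /\
  (\int[P]_w (V' w)%:E <= \int[P]_w (Num.max (V w) 0)%:E)%E.
Proof.
move=> p0 mJ JQ mG indep mV mV' hV' GV.
pose Gp s w := if Q s then Num.max (G s w) 0 else 0.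
have mGp s : measurable_fun setT (Gp s).
  rewrite /Gp; have [Qs|_] := boolP (Q s); last exact: measurable_cst.
  by apply: measurable_maxr => //; exact: mG.
have Gp0 s w : 0 <= Gp s w by rewrite /Gp; case: ifP; rewrite // le_max lexx orbT.
(* On the event [J = s], [G s] dominates [V'] and is nonnegative, so that event misses [G s < 0].
   Independence and [p > 0] force the latter to have probability zero. *)
have null s : Q s -> P (G s @^-1` `]-oo, 0[) = 0%E.
  move=> Qs; have := indep s `]-oo, 0[%classic Qs (measurable_itv _).
  rewrite (_ : _ `&` _ = set0) ?measure0; last first.
    apply/seteqP; split=> // w [/= <-]; rewrite in_itv /= => h.
    by have /andP[h1 h2] := hV' w; have := lt_le_trans h (le_trans h1 h2); rewrite ltxx.
  by move=> /esym/eqP; rewrite mule_eq0 eqe gt_eqF //= => /eqP.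
have aeG : {ae P, forall w, forall s, Q s -> 0 <= G s w}.
  apply: filter_forall => s; have [Qs|nQs] := boolP (Q s); last first.
    by apply: nearW => w.
  exists (G s @^-1` `]-oo, 0[); split.
  - by rewrite -[X in measurable X]setTI; apply: mG => //; exact: measurable_itv.
  - exact: null.
  - by move=> w /=; rewrite in_itv /= => h; rewrite ltNge; apply/negP => h0; exact: h.
have aeV : {ae P, forall w, p * \sum_s Gp s w = Num.max (V w) 0}.
  apply: filterS aeG => w h.
  have V0 : 0 <= V w by rewrite -GV mulr_ge0 ?(ltW p0) // sumr_ge0.
  rewrite max_l // -GV [in RHS]big_mkcond; congr (_ * _); apply: eq_bigr => s _.
  by rewrite /Gp; case: ifPn => // Qs; rewrite max_l // h.
split.
  (* An almost sure property under a measure of positive mass holds at some point. *)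
  have PT0 : (0 < P setT)%E by rewrite probability_setT lte01.
  have [w h] := @filter_ex _ _ (ae_properfilter_algebraOfSetsType PT0) _ aeG.
  by exists w; rewrite -GV mulr_ge0 ?(ltW p0) // sumr_ge0.
have mI s : measurable_fun setT (fun w => (\1_(J @^-1` [set s]) w * Gp s w)%:E).
  by apply/measurable_EFinP; apply: measurable_funM.
(* [G (J w) w] is the sum over [s] of the indicator of [J = s] times [G s]; truncating each term
   only increases it. *)
apply: (@le_trans _ _
    (\int[P]_w (\sum_(s : K) (\1_(J @^-1` [set s]) w * Gp s w)%:E)%E)%E).
  apply: ge0_le_integral => //.
  - by move=> w _; rewrite lee_fin; case/andP: (hV' w).
  - exact/measurable_EFinP.
  - exact: (emeasurable_sum _ mI).
  - move=> w _; rewrite sumEFin lee_fin (bigD1 (J w)) //= indicE mem_set // mul1r.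
    apply: (le_trans (y := Gp (J w) w)).
      by rewrite /Gp JQ le_max; case/andP: (hV' w) => _ ->.
    by rewrite lerDl sumr_ge0 // => s _; rewrite mulr_ge0.
rewrite ge0_integral_sum //; last first.
  by move=> s w _; rewrite lee_fin mulr_ge0.
have indepGp s : (\int[P]_w (\1_(J @^-1` [set s]) w * Gp s w)%:E =
    \int[P]_w (p * Gp s w)%:E)%E.
  have [Qs|nQs] := boolP (Q s); last first.
    by apply: eq_integral => w _; rewrite /Gp (negbTE nQs) !mulr0.
  under [RHS]eq_integral do rewrite EFinM.
  rewrite ge0_integralZl ?lee_fin ?(ltW p0) //; last 2 first.
    exact/measurable_EFinP.
    by move=> w _; rewrite lee_fin.
  rewrite -(integral_indep (mJ s)) ?(ltW p0) //; last first.
    move=> B mB; have mB' : measurable ((fun a : R => Num.max a 0) @^-1` B).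
      by rewrite -[X in measurable X]setTI; exact: measurable_maxr.
    have -> : Gp s @^-1` B = G s @^-1` ((fun a : R => Num.max a 0) @^-1` B).
      by rewrite /Gp Qs.
    exact: indep.
  rewrite [RHS]integral_mkcond; apply: eq_integral => w _.
  by rewrite patchE indicE; case: ifP => _; rewrite ?mul1r ?mul0r.
rewrite (eq_bigr _ (fun s _ => indepGp s)) -ge0_integral_sum //; last 2 first.
- by move=> s; apply/measurable_EFinP; exact: measurable_funM.
- by move=> s w _; rewrite lee_fin mulr_ge0 // ltW.
rewrite le_eqVlt; apply/orP; left; apply/eqP; apply: ge0_ae_eq_integral => //.
- by apply: emeasurable_sum => s; apply/measurable_EFinP; exact: measurable_funM.
- by apply/measurable_EFinP; exact: measurable_maxr.
- by move=> w _; apply: sume_ge0 => s _; rewrite lee_fin mulr_ge0 // ltW.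
- by move=> w _; rewrite lee_fin le_max lexx orbT.
- by apply: filterS aeV => w h _; rewrite sumEFin -mulr_sumr h.
Qed.

End RandomDraw.

(** * Measurability of the energy and of the block gaps *)

Section TrajectoryMeasurability.
Context {R : realType} {N : nat} {d : 'I_N -> nat} {m : nat}.
Context (f : 'cV[R]_(\sum_i d i) -> R) (u : forall i, 'cV[R]_(d i) -> \bar R).
Context (X : forall i, set 'cV[R]_(d i)).
Context (A : 'M[R]_(m, \sum_i d i)) (b : 'cV[R]_m).
Context (Phat : 'M[R]_(\sum_i d i)) (rhox rho theta : R).
Context (xs : 'cV[R]_(\sum_i d i)).
Context (conv : convexity f u X).
Context {disp : measure_display} {T : measurableType disp}.

Lemma measurable_cvD n (y z : T -> 'cV[R]_n) :
  (forall c, measurable_fun setT (fun w => y w c ord0)) ->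
  (forall c, measurable_fun setT (fun w => z w c ord0)) ->
  forall c, measurable_fun setT (fun w => (y w + z w) c ord0).
Proof. by move=> my mz c; under eq_fun do rewrite mxE; exact: measurable_funD. Qed.

Lemma measurable_cvZ n a (y : T -> 'cV[R]_n) :
  (forall c, measurable_fun setT (fun w => y w c ord0)) ->
  forall c, measurable_fun setT (fun w => (a *: y w) c ord0).
Proof. by move=> my c; under eq_fun do rewrite mxE; exact: measurable_funM. Qed.

Lemma measurable_cvN n (y : T -> 'cV[R]_n) :
  (forall c, measurable_fun setT (fun w => y w c ord0)) ->
  forall c, measurable_fun setT (fun w => (- y w) c ord0).
Proof. by move=> my c; under eq_fun do rewrite mxE; exact: measurable_funN. Qed.

Lemma measurable_submxcol (y : T -> 'cV[R]_(\sum_i d i)) i :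
  (forall c, measurable_fun setT (fun w => y w c ord0)) ->
  forall c, measurable_fun setT (fun w => (submxcol (y w) i) c ord0).
Proof. by move=> my c; under eq_fun do rewrite mxE; exact: my. Qed.

Lemma measurable_usum_term (y : T -> 'cV[R]_(\sum_i d i)) i :
  (forall c, measurable_fun setT (fun w => y w c ord0)) ->
  (forall w, ufin u (y w)) ->
  measurable_fun setT (fun w => fine (u (submxcol (y w) i))).
Proof.
move=> my yf; apply: (measurable_comp_pcc (y := fun w => submxcol (y w) i)).
- exact: measurable_submxcol.
- exact: (u_pcc conv).
- by move=> w; exact: yf.
Qed.

Lemma measurable_fobj (y : T -> 'cV[R]_(\sum_i d i)) :
  (forall c, measurable_fun setT (fun w => y w c ord0)) ->
  (forall w, ufin u (y w)) -> measurable_fun setT (fun w => fobj f u (y w)).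
Proof.
move=> my yf; have [_ [df _] _] := conv.
apply: measurable_funD.
  by apply: measurable_comp_continuous => // z; exact: differentiable_continuous.
by apply: measurable_sum => i; exact: measurable_usum_term.
Qed.

Context (x : nat -> T -> 'cV[R]_(\sum_i d i)) (r l : nat -> T -> 'cV[R]_m).
Context (k : nat).
Context (mx : forall j c, (j <= k)%N ->
  measurable_fun setT (fun w => x j w c ord0)).
Context (x_fin : forall j w, ufin u (x j w)).
Context (rE : forall j w, r j w = A *m x j w - b).
Context (l0 : forall w, l 0%N w = 0).
Context (lS : forall j w, l j.+1 w = l j w - rho *: r j.+1 w).

Lemma measurable_residual j c : (j <= k)%N ->
  measurable_fun setT (fun w => r j w c ord0).
Proof.
move=> jk; under eq_fun do rewrite rE.
apply: measurable_cvD => // c'; apply: measurable_mulmx => c''; exact: mx.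
Qed.

Lemma measurable_multiplier j c : (j <= k)%N ->
  measurable_fun setT (fun w => l j w c ord0).
Proof.
elim: j c => [|j IH] c jk.
  by under eq_fun do rewrite l0; exact: measurable_cst.
under eq_fun do rewrite lS.
apply: measurable_cvD => c'; first by apply: IH; exact: ltnW.
by apply: measurable_cvN; apply: measurable_cvZ => c''; exact: measurable_residual.
Qed.

(** Only the iterates up to [k] are assumed measurable, so the result applies to the ambient
    sigma-algebra and also to the one generated by the history. *)
Lemma measurable_energy : measurable_fun setT (fun w =>
  energy f u A Phat rhox theta xs (x ^~ w) (r ^~ w) (l ^~ w) k).
Proof.
have mlg j : (j <= k)%N ->
    measurable_fun setT (fun w => lagr_gap f u xs (x j w) (r j w) (l j w)).
  move=> jk; apply: measurable_funB; first apply: measurable_funB => //.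
    by apply: measurable_fobj => // c; exact: mx.
  by apply: measurable_dotv => c; [exact: measurable_residual|exact: measurable_multiplier].
have mxxs c : measurable_fun setT (fun w => (x k w - xs) c ord0).
  by apply: measurable_cvD => // c'; exact: mx.
rewrite /energy; apply: measurable_funD; first apply: measurable_funD.
- apply: measurable_funD; apply: measurable_funM => //; first exact: mlg.
  (* Keeping the range condition in the sum ensures that only indices [j <= k] have to be
     handled. *)
  under eq_fun do rewrite big_nat_cond.
  under eq_fun do rewrite big_mkcond.
  apply: measurable_sum => j.
  have [/andP[/andP[_ jk] _]|_] := boolP ((1 <= j < k.+1)%N && true) => //.
  exact: mlg.
- apply: measurable_funM => //.
  by apply: measurable_dotv => c; exact: measurable_residual.
- apply: measurable_funM => //.
  by apply: measurable_dotv => // c; exact: measurable_mulmx.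
Qed.

Lemma measurable_block_gap i : measurable_fun setT (fun w =>
  block_gap f u A rhox xs (x k w) (r k w) (l k w) i).
Proof.
have [_ [df _] _] := conv.
apply: measurable_funD; last first.
  by apply: measurable_funB => //; apply: measurable_usum_term => // c; exact: mx.
apply: measurable_dotv; apply: measurable_submxcol.
  apply: measurable_cvD; last first.
    apply: measurable_cvZ => c; apply: measurable_mulmx => c'.
    exact: measurable_residual.
  apply: measurable_cvD.
    by move=> c; apply: measurable_grad => // c'; exact: mx.
  apply: measurable_cvN => c; apply: measurable_mulmx => c'.
  exact: measurable_multiplier.
by apply: measurable_cvD => // c; exact: mx.
Qed.

End TrajectoryMeasurability.

(** After exchanging the sums, each index is counted once per subset containing it; this number is
    [C(N, n) - C(N - 1, n)], by removing the subsets that avoid it. Hence a uniform draw keeps the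
    fraction [n / N] of the total on average. *)
Lemma sum_subsets_card (R : comPzRingType) N n (a : 'I_N -> R) :
  N%:R * \sum_(S : {set 'I_N} | #|S| == n) \sum_(i in S) a i =
  n%:R * 'C(N, n)%:R * \sum_i a i.
Proof.
rewrite (exchange_big_dep xpredT) //= !mulr_sumr; apply: eq_bigr => i _.
rewrite sumr_const -(mulr_natl (a i)) mulrA -!natrM; congr (_%:R * _).
have h : (#|[pred S : {set 'I_N} | (#|S| == n) && (i \in S)]| +
    'C(N.-1, n) = 'C(N, n))%N.
  have <- : #|[set S : {set 'I_N} | #|S| == n]%SET| = 'C(N, n).
    by rewrite card_draws card_ord.
  have <- : #|[set S : {set 'I_N} | (S \subset [set~ i]%SET) && (#|S| == n)]%SET| =
      'C(N.-1, n).
    by rewrite cards_draws cardsC1 card_ord.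
  rewrite -cardsE -[RHS](cardsID [set S : {set 'I_N} | i \in S]%SET); congr addn.
    by apply: eq_card => S; rewrite !inE.
  by apply: eq_card => S; rewrite !inE finset.subsetC finset.sub1set inE.
have [nN|Nn] := leqP n N; last first.
  move: h; rewrite (bin_small Nn) => /eqP; rewrite addn_eq0 => /andP[/eqP -> _].
  by rewrite !muln0.
have := mul_bin_down N n; rewrite mulnBl => h2.
have h3 : (n * 'C(N, n) <= N * 'C(N, n))%N by rewrite leq_mul2r nN orbT.
apply/eqP; rewrite -(eqn_add2r (N * 'C(N.-1, n))) -mulnDr h h2.
by rewrite subnKC.
Qed.

(** * From the pathwise energy inequality to bounds in expectation *)

Theorem theorem3p6 (R : realType) (N : nat) (d : 'I_N -> nat) (m : nat)
    (f : 'cV[R]_(\sum_i d i) -> R)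
    (u : forall i : 'I_N, 'cV[R]_(d i) -> \bar R)
    (X : forall i : 'I_N, set 'cV[R]_(d i))
    (A : 'M[R]_(m, \sum_i d i)) (b : 'cV[R]_m)
    (n : nat) (Lf rhox rho : R) (Phat : 'M[R]_(\sum_i d i))
    (x0 : 'cV[R]_(\sum_i d i))
    (disp : measure_display) (T : measurableType disp) (P : probability T R)
    (I : nat -> T -> {set 'I_N}) (x : nat -> T -> 'cV[R]_(\sum_i d i))
    (r lam : nat -> T -> 'cV[R]_m)
    (t : nat) (xs : 'cV[R]_(\sum_i d i)) (ls : 'cV[R]_m) :
  let theta : R := n%:R / N%:R in
  let F := objective f u in
  let xhat := ergodic_average x theta t in
  let Ptilde := Phat - rhox *: (A^T *m A) in
  (1 <= n <= N)%N ->
  convexity f u X ->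
  lipschitz_partial_gradient n Lf f ->
  psd Phat -> block_diagonal Phat ->
  0 < rhox -> 0 < rho -> rho = theta * rhox ->
  generated_by_algorithm f u X A b Phat rhox rho n x0 P I x r lam ->
  (forall k w, loewner_ge (prox_matrix Phat rhox A (I k w)) Lf%:M) ->
  (1 <= t)%N ->
  primal_dual_solution f u X A b xs ls ->
  (Order.max `| \int[P]_w (F (xhat w) - F xs) |
             ('E_P[fun w => enorm (A *m xhat w - b)])
   <= ((1 + theta * t%:R)^-1)%:E *
      ((1 - theta)%:E *
         (F x0 - F xs + (rhox * enorm (A *m x0 - b) ^+ 2)%:E)
       + (2^-1 * wnorm2 Ptilde (x0 - xs)
          + Num.max ((1 + enorm ls) ^+ 2) (4 * enorm ls ^+ 2)
              / (2 * rhox))%:E))%E.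

Proof.
move=> theta F xhat Ptilde /andP[n1 nN] conv lip Phat_psd Phat_diag rhox0 rho0
  rhoE HG prox_ge t1 [Xxs Axs opt].
have N0 : (0 < N)%N by exact: leq_trans nN.
have theta0 : 0 < theta by rewrite divr_gt0 ?ltr0n.
(* Testing optimality at [x0], where the objective is below [+oo], excludes the value [+oo] at
   [xs]. *)
have xs_fin : ufin u xs.
  apply: (objective_lty conv); have := opt x0 (init_feasible HG).
  have := init_finite HG.
  by case: (objective f u xs) => [a|//|//]; rewrite ?ltry //; case: (objective f u x0).
have x0_fin : ufin u x0 := objective_lty conv (init_finite HG).
have xs_opt z : prodset X z -> ufin u z ->
    0 <= fobj f u z - fobj f u xs - dotv (A *m z - b) ls.
  move=> Xz zf; have := opt z Xz.
  by rewrite !(objectiveE conv) // -!EFinD lee_fin dotv_mull trmxK mulmxBr Axs.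
have x0f w : ufin u (x 0%N w) by rewrite (init_x HG).
have x0X w : prodset X (x 0%N w) by rewrite (init_x HG); exact: init_feasible HG.
have l0 w : lam 0%N w = 0 := init_lam HG w.
have r0 w : r 0%N w = A *m x 0%N w - b by rewrite (init_r HG) (init_x HG).
have fixed w k i : i \notin I k w -> submxcol (x k.+1 w) i = submxcol (x k w) i.
  exact: (step_fixed HG).
have argm w k := step_argmin HG k w.
have rS w k := step_r HG k w.
have lS w k := step_lam HG k w.
have x_fin k w : ufin u (x k w).
  exact: (iterate_ufin conv Phat_diag Xxs xs_fin (x0f w) (fixed w) (argm w)).
have rE k w : r k w = A *m x k w - b.
  exact: (residualE (r0 w) (fixed w) (rS w)).
pose c := Num.max ((1 + enorm ls) ^+ 2) (4 * enorm ls ^+ 2) / (2 * rhox).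
pose V k w := energy f u A Phat rhox theta xs (x ^~ w) (r ^~ w) (lam ^~ w) k.
pose gap k i w := block_gap f u A rhox xs (x k w) (r k w) (lam k w) i.
have bound k w := energy_bound conv theta0 rhox0 rhoE Phat_psd Phat_diag Xxs xs_fin
  Axs (x0f w) (x0X w) (l0 w) (r0 w) (fixed w) (argm w) (rS w) (lS w) xs_opt k.
have V_ge0 k w : 0 <= V k.+1 w + c.
  have [_] := bound k w; rewrite /= -/c; apply: le_trans.
  by rewrite mulr_ge0 ?enorm_ge0 // ltW // weight_gt0.
have step k w : V k.+1 w <= V k w - \sum_(i in I k w) gap k i w
    + theta * \sum_i gap k i w.
  exact: (energy_step conv theta0 rhoE Phat_psd Phat_diag Xxs xs_fin Axs
    (fun k => draw_card HG k w) lip (fun k => prox_ge k w) (x0f w) (r0 w) (fixed w)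
    (argm w) (rS w) (lS w)).
have mx k c' : measurable_fun setT (fun w => x k w c' ord0) :=
  iterate_measurable HG k c'.
have mV k : measurable_fun setT (fun w => V k w + c).
  apply: measurable_funD => //.
  exact: (measurable_energy Phat rhox theta xs conv (fun j c _ => mx j c) x_fin rE
    l0 (fun j w => lS w j)).
pose p : R := ('C(N, n)%:R)^-1.
have C0 : 0 < 'C(N, n)%:R :> R by rewrite ltr0n bin_gt0.
have p0 : 0 < p by rewrite invr_gt0.
(* The right side of the energy inequality, shifted by [c], for a hypothetical draw [S]. It depends
   only on the history before the draw, and its mean over all [S] is [V k w + c]. *)
pose G k (S : {set 'I_N}) w := V k w + c - \sum_(i in S) gap k i w
  + theta * \sum_i gap k i w.
have GV k w : p * \sum_(S : {set 'I_N} | #|S| == n) G k S w = V k w + c.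
  rewrite /G (eq_bigr (fun S : {set 'I_N} => (V k w + c + theta * \sum_i gap k i w)
    + - \sum_(i in S) gap k i w)); last by move=> S _; rewrite addrAC.
  rewrite big_split /= sumrN sumr_const.
  have -> : #|[pred S : {set 'I_N} | #|S| == n]| = 'C(N, n).
    by rewrite -cardsE card_draws card_ord.
  have -> : \sum_(S : {set 'I_N} | #|S| == n) \sum_(i in S) gap k i w =
      theta * 'C(N, n)%:R * \sum_i gap k i w.
    have Nu : N%:R != 0 :> R by rewrite pnatr_eq0 -lt0n.
    by apply: (mulfI Nu); rewrite sum_subsets_card /theta; field.
  by rewrite -mulr_natl /p; field; rewrite gt_eqF.
have draw k : (exists w, 0 <= V k w + c) /\
    (\int[P]_w (V k.+1 w + c)%:E <= \int[P]_w (Num.max (V k w + c) 0)%:E)%E.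
  (* These sets generate the history; measurability for the sigma-algebra they generate is what
     independence of the draw requires. *)
  pose Gen : set (set T) := [set E |
    (exists j S, (j < k)%N /\ E = I j @^-1` [set S]) \/
    (exists j c (B : set R), [/\ (j <= k)%N, measurable B &
       E = (fun w => x j w c ord0) @^-1` B])].
  have mxh j c' : (j <= k)%N -> measurable_fun (setT : set (g_sigma_algebraType Gen))
      (fun w : g_sigma_algebraType Gen => x j w c' ord0).
    move=> jk _ B mB; rewrite setTI; apply: sub_sigma_algebra; right.
    by exists j, c', B.
  have mGh S : measurable_fun (setT : set (g_sigma_algebraType Gen)) (G k S).
    have mg i : measurable_fun (setT : set (g_sigma_algebraType Gen)) (gap k i).
      exact: (measurable_block_gap rhox xs conv (T := g_sigma_algebraType Gen)
        mxh x_fin rE l0 (fun j w => lS w j)).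
    have mVh : measurable_fun (setT : set (g_sigma_algebraType Gen)) (V k).
      exact: (measurable_energy Phat rhox theta xs conv
        (T := g_sigma_algebraType Gen) mxh x_fin rE l0 (fun j w => lS w j)).
    apply: measurable_funD; first apply: measurable_funB.
    - exact: measurable_funD.
    - under eq_fun do rewrite big_mkcond.
      by apply: measurable_sum => i; have [_|_] := boolP (i \in S).
    - by apply: measurable_funM => //; apply: measurable_sum.
  have mGB S B : measurable B -> history I x k (G k S @^-1` B).
    by move=> mB; have := mGh S measurableT B mB; rewrite setTI.
  apply: (integral_draw_le (J := I k) (Q := fun S => #|S| == n) (p := p) (G := G k)).
  - exact: p0.
  - exact: draw_measurable HG k.
  - by move=> w; rewrite (draw_card HG).
  - move=> S _ _ B mB; rewrite setTI.
    have hG : history I x k `<=` measurable.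
      apply: smallest_sub; first exact: sigma_algebra_measurable.
      move=> _ [[j [S' [_ ->]]]|[j [c' [B' [_ mB' ->]]]]].
        exact: draw_measurable HG j S'.
      by have := mx j c' measurableT B' mB'; rewrite setTI.
    by apply: hG; exact: mGB.
  - move=> S B /eqP cS mB; rewrite (draw_independent HG) ?(draw_uniform HG) //.
    exact: mGB.
  - exact: mV.
  - exact: mV.
  - move=> w; rewrite V_ge0 /=; have := step k w; rewrite /G; lra.
  - exact: GV.
have V0E w : V 0%N w = (1 - theta) * (fobj f u x0 - fobj f u xs +
    rhox * enorm (A *m x0 - b) ^+ 2) + 2^-1 * wnorm2 Ptilde (x0 - xs).
  rewrite /V /energy big_geq // /lagr_gap l0 r0 (init_x HG) dotv0r enorm2E.
  rewrite /Ptilde; lra.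
have main : (\int[P]_w (V t.+1 w + c)%:E <= ((1 - theta) * (fobj f u x0 - fobj f u xs +
    rhox * enorm (A *m x0 - b) ^+ 2) + 2^-1 * wnorm2 Ptilde (x0 - xs) + c)%:E)%E.
  elim: {t1 xhat} t => [|t IH].
    (* The initial energy is deterministic, so its nonnegativity after the shift at one point
       removes the truncation everywhere. At later steps [V_ge0] removes it pointwise. *)
    have [[w0 Vw0] /le_trans] := draw 0%N; apply.
    under eq_integral do rewrite V0E.
    rewrite V0E in Vw0; rewrite max_l // integral_cst //.
    rewrite [X in (_ * X <= _)%E](_ : _ = 1%E) ?mule1 //.
    exact: probability_setT.
  have [_ /le_trans] := draw t.+1; apply.
  by under eq_integral do rewrite max_l //.
set B0 := (1 - theta) * _ + _ in main.
have W0 : 0 < 1 + theta * t%:R := weight_gt0 theta0 t.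
have intb (g : T -> R) : measurable_fun setT g -> (forall w, 0 <= g w) ->
    (forall w, (1 + theta * t%:R) * g w <= V t.+1 w + c) ->
    (\int[P]_w (g w)%:E <= ((1 + theta * t%:R)^-1 * (B0 + c))%:E)%E.
  move=> mg g0 gV; rewrite EFinM.
  apply: (@le_trans _ _
    ((1 + theta * t%:R)^-1%:E * \int[P]_w (V t.+1 w + c)%:E)%E); last first.
    by apply: lee_wpmul2l main; rewrite lee_fin invr_ge0 ltW.
  rewrite -ge0_integralZl ?lee_fin ?invr_ge0 ?(ltW W0) //; last 2 first.
  - by apply/measurable_EFinP; exact: mV.
  - by move=> w _; rewrite lee_fin V_ge0.
  apply: ge0_le_integral => //.
  - by move=> w _; rewrite lee_fin.
  - exact/measurable_EFinP.
  - by apply/measurable_EFinP; apply: measurable_funM => //; exact: mV.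
  - by move=> w _; rewrite -EFinM lee_fin ler_pdivlMl.
have x_X k w : prodset X (x k w) by exact: (iterate_X (x0X w) (fixed w) (argm w)).
have xhat_fin w : ufin u (xhat w).
  by have [] := weighted_average_jensen conv theta0 t (x_fin t.+1 w) (x_X t.+1 w)
    (x_fin ^~ w) (x_X ^~ w).
have mxhat c' : measurable_fun setT (fun w => xhat w c' ord0).
  apply: measurable_cvZ => j; apply: measurable_cvD => // j'.
  apply: measurable_cvZ => i; under eq_fun do rewrite summxE.
  by apply: measurable_sum.
rewrite /F (objectiveE conv x0_fin) (objectiveE conv xs_fin) -!(EFinM, EFinD).
rewrite addrA -/c ge_max; apply/andP; split.
  have mD : measurable_fun setT (fun w => fobj f u (xhat w) - fobj f u xs).
    by apply: measurable_funB => //; exact: (measurable_fobj conv).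
  under eq_integral do rewrite (objectiveE conv) // -EFinD.
  (* The absolute value moves inside the expectation, which gives a nonnegative integrand controlled
     by [bound]. *)
  apply: le_trans (le_abse_integral _ _ _) _ => //; first exact/measurable_EFinP.
  apply: intb => [|w|w]; first exact: measurableT_comp.
    exact: normr_ge0.
  by have [] := bound t w.
rewrite unlock; apply: intb.
- apply: measurable_enorm; apply: measurable_cvD => // j; exact: measurable_mulmx.
- by move=> w; exact: enorm_ge0.
- by move=> w; have [_] := bound t w.
Qed.
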